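(* Let $\theta_1,\theta_2\in\Theta_+$. Then the metrics $d_{\theta_1}$ and $d_{\theta_2}$ on $\mathcal I$ are equivalent, i.e. there exist $k,\ell\in\mathbb R_{>0}$ such that $k\,d_{\theta_1}\le d_{\theta_2}\le \ell\, d_{\theta_1}$.
   Context: **Vectorial data.** $I$ is a finite set and $C=(c_{i,j})_{i,j\in I}$ is a Kac--Moody matrix: $c_{i,j}\in\mathbb Z$, $c_{i,i}=2$, $c_{i,j}\le 0$ for $i\neq j$, and $c_{i,j}=0\iff c_{j,i}=0$. $X,Y$ are dual free $\mathbb Z$-modules of finite rank with $\mathbb Z$-linearly independent families $(\alpha_i)_{i\in I}$ in $X$ and $(\alpha_i^\vee)_{i\in I}$ in $Y$ such that $\alpha_j(\alpha_i^\vee)=c_{i,j}$. $\mathbb A=Y\otimes\mathbb R$, with its usual topology; elements of $X$ are linear forms on $\mathbb A$. $r_i(v)=v-\alpha_i(v)\alpha_i^\vee$, and $W^v=\langle r_i\mid i\in I\rangle\subset \mathrm{GL}(\mathbb A)$ (Weyl group), acting on $\mathbb A^*$ by $(w.\alpha)(x)=\alpha(w^{-1}x)$. $\Phi=\{w.\alpha_i\}$ is the set of real roots; for $\alpha=w.\alpha_i\in\Phi$, $\alpha^\vee=w.\alpha_i^\vee$. $Q^\vee=\bigoplus_i\mathbb Z\alpha_i^\vee$ and $W^a=Q^\vee\rtimes W^v$. $\Delta\subset\bigoplus_i\mathbb Z\alpha_i\subset\mathbb A^*$ is the set of all (real and imaginary) roots of the Kac--Moody algebra of $C$. For $\alpha\in\mathbb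 A^*$, $k\in\mathbb R$: $D(\alpha,k)=\{\alpha(x)+k\ge0\}$, $D^\circ(\alpha,k)=\{\alpha(x)+k>0\}$, $M(\alpha,k)=\{\alpha(x)+k=0\}$, and $D(\alpha,+\infty)=D^\circ(\alpha,+\infty)=\mathbb A$. Walls (resp. half-apartments) are the $M(\alpha,k)$ (resp. $D(\alpha,k)$), $\alpha\in\Phi$, $k\in\mathbb Z$. $C^v_f=\{v\mid\alpha_i(v)>0\ \forall i\}$; for $J\subset I$, $F^v(J)=\{v\mid \alpha_i(v)=0\ (i\in J),\ \alpha_i(v)>0\ (i\notin J)\}$. Positive (resp. negative) vectorial faces are the $w.F^v(J)$ (resp. $-w.F^v(J)$), $w\in W^v$; vectorial chambers are the $\pm w.C^v_f$. Tits cone: $\mathcal T=\bigcup_{w}w.\overline{C^v_f}$. A vectorial face is spherical if it meets $\pm\mathring{\mathcal T}$. $x\le y$ means $y-x\in\mathcal T$. A ray or segment through $x\ne y$ from $x$ is preordered if $x\le y$ or $y\le x$, generic if $y-x\in\pm\mathring{\mathcal T}$. **Filters.** A filter lies in a set $Z$ if $Z$ is an element of it; a set (e.g. an apartment) contains a filter if it contains an element of it; a map fixes a filter if it fixes pointwise some element of it. The support of a filter is the smallest affine subspace containing it. $\mathcal F\Cup\mathcal F'=\{E\cup E'\mid E\in\mathcal F,E'\in\mathcal F'\}$. The enclosure $\mathrm{cl}(\mathcal F)$ of a filter on $\mathbb A$ is the filter of sets $E$ containing some $\bigcap_{\alpha\in\Delta}D(\alpha,k_\alpha)\in\mathcal F$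 with $k_\alpha\in\mathbb Z\cup\{+\infty\}$ (a set is treated as its principal filter). A sector-face is $f=x+F^v$ ($F^v$ a vectorial face); its germ at infinity is the filter of sets containing $x+u+F^v$ for some $u\in\overline{F^v}$. If $F^v$ is a vectorial chamber, $f$ is a sector and its germ is a sector-germ, with the sign of $F^v$; $\pm\infty$ is the germ of $\pm C^v_f$. The face $F(x,F^v)$ is the filter of sets $E$ for which there are $k_\alpha,k'_\alpha\in\mathbb Z\cup\{+\infty\}$ $(\alpha\in\Delta)$ and a neighbourhood $\Omega$ of $x$ with $E\supset\bigcap_{\alpha}(D(\alpha,k_\alpha)\cap D^\circ(\alpha,k'_\alpha))\supset\Omega\cap(x+F^v)$. A chamber (resp. panel) is a face with support $\mathbb A$ (resp. a wall). A chimney is $\mathfrak r(F,F^v)=\mathrm{cl}(F+F^v)$, $F$ a face, $F^v$ a vectorial face; it is splayed if $F^v$ is spherical, solid if the pointwise stabilizer in $W^v$ of the direction of its support is finite. Its germ is the filter of sets belonging to some $\mathfrak r(F+u,F^v)$, $u\in\overline{F^v}$. **Apartments.** $\mathrm{Aut}(\mathbb A)$ is the group of affine bijections of $\mathbb A$ stabilizing $\{(M(\alpha,k),\alpha^\vee)\mid\alpha\in\Phi,k\in\mathbb Z\}$. An apartment of type $\mathbb A$ is a set $A$ with a nonempty set $\mathrm{Isom}^w(\mathbb A,A)$ of bijections $\mathbb A\to A$ forming one orbit $f_0\circ W^a$. A bijection $\phi:A\to A'$ is a Weyl isomorphism (resp. an isomorphism, which here always means vectorially Weyl isomorphism) if $f'^{-1}\circ\phi\circ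 f\in W^a$ (resp. $\in(W^v\ltimes\mathbb A)\cap\mathrm{Aut}(\mathbb A)$) for $f\in\mathrm{Isom}^w(\mathbb A,A)$, $f'\in\mathrm{Isom}^w(\mathbb A,A')$. All above notions, the affine structure and the affine topology are transported to every apartment. **Masure.** A masure of type $\mathbb A$ is a set $\mathcal I$ covered by a family of subsets called apartments such that: (MA1) each apartment has a structure of apartment of type $\mathbb A$. (MA2) If $F$ is a point, a germ of a preordered interval, a generic ray or a solid chimney in an apartment $A$, and $A'$ is another apartment containing $F$, then $A\cap A'$ contains $\mathrm{cl}_A(F)$ and there is a Weyl isomorphism $A\to A'$ fixing $\mathrm{cl}_A(F)$. (MA3) If $\mathfrak R$ is the germ of a splayed chimney and $F$ is a face or a germ of a solid chimney, some apartment contains $\mathfrak R$ and $F$. (MA4) If apartments $A,A'$ contain $\mathfrak R$ and $F$ as in (MA3), there is a Weyl isomorphism $A\to A'$ fixing $\mathrm{cl}_A(\mathfrak R\Cup F)$. (MAO) If $x,y\in A\cap A'$ and $x\le_A y$ then $[x,y]_A=[x,y]_{A'}$. Standing assumptions: $\mathcal I$ is such a masure; each panel lies in the closure of finitely many, and more than $2$, chambers; a group $G$ acts strongly transitively on $\mathcal I$ (it permutes apartments, each $g:A\to g.A$ is an isomorphism of apartments, and all isomorphisms in the axioms are induced by elements of $G$); $\mathbb A$ is identified with a fixed apartment of $\mathcal I$, and the stabilizer of $\mathbb A$ in $G$ induces on $\mathbb A$ the group $W^v\ltimes Y$. $\mathcal I$ is a building if and only if $W^v$ is finite. Sector-germs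 of $\mathcal I$ are sector-germs of its apartments (a sector-germ contained in an apartment $B$ is a sector-germ of $B$, of the same sign). **Distances.** Let $\mathfrak s$ be a sector-germ of sign $\mathrm{sgn}(\mathfrak s)\in\{+,-\}$, $x\in\mathcal I$, $u\in\overline{C^v_f}$. Choose an apartment $A_1$ containing $x$ and $\mathfrak s$ and an isomorphism $\psi:\mathbb A\to A_1$ with $\psi(\mathrm{sgn}(\mathfrak s)\infty)=\mathfrak s$; then $x+_{\mathfrak s}u:=\psi(\psi^{-1}(x)+\mathrm{sgn}(\mathfrak s)u)$ is independent of choices. $U_{\mathfrak s}(x,x')=\{(u,u')\in\overline{C^v_f}^2\mid x+_{\mathfrak s}u=x'+_{\mathfrak s}u'\}$, which is nonempty. $\Theta_+$ (resp. $\Theta_-$) is the set of pairs $\theta=(|\cdot|,\mathfrak s)$ with $|\cdot|$ a norm on $\mathbb A$ and $\mathfrak s$ a positive (resp. negative) sector-germ of $\mathcal I$. For such $\theta$, $d_\theta(x,x')=\inf\{|u|+|u'|\mid(u,u')\in U_{\mathfrak s}(x,x')\}$ is a distance on $\mathcal I$. *)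

(* Defs.v *)
From HB Require Import structures.
From mathcomp Require Import all_boot all_order all_algebra.
From mathcomp Require Import all_classical all_reals all_analysis.
From mathcomp Require Import complex.

Set Implicit Arguments.
Unset Strict Implicit.
Unset Printing Implicit Defensive.

Import Order.TTheory GRing.Theory Num.Theory.
Import numFieldNormedType.Exports.
Local Open Scope classical_set_scope.
Local Open Scope ring_scope.

(* The dual free modules of rank n are X = 'rV[int]_n and Y = 'cV[int]_n, the
   duality being the matrix product. *)
Record root_datum (I : finType) (n : nat) := RootDatum {
  cartan : I -> I -> int;
  sroot : I -> 'rV[int]_n;
  scoroot : I -> 'cV[int]_n;
  cartan_diag : forall i, cartan i i = 2;
  cartan_offdiag : forall i j, i != j -> cartan i j <= 0;
  cartan_eq0 : forall i j, cartan i j = 0 <-> cartan j i = 0;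
  sroot_free : forall c : I -> int,
    \sum_i c i *: sroot i = 0 -> forall i, c i = 0;
  scoroot_free : forall c : I -> int,
    \sum_i c i *: scoroot i = 0 -> forall i, c i = 0;
  sroot_scoroot : forall i j, (sroot j *m scoroot i) 0 0 = cartan i j
}.

Definition intmx (K : pzRingType) (m n : nat) (A : 'M[int]_(m, n)) :
  'M[K]_(m, n) := map_mx (fun z : int => z%:~R) A.
Arguments intmx K {m n} A.

Definition pairing (K : pzRingType) (n : nat) (a : 'rV[K]_n) (x : 'cV[K]_n) : K :=
  (a *m x) 0 0.

Section KacMoodyAlgebra.
Context (K : fieldType) (I : finType) (n : nat) (S : root_datum I n).

(* Terms denoting elements of the Lie algebra over K generated by e_i, f_i and
   the Cartan subalgebra h = Y (x) K. *)
Inductive km_term : Type :=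
| km_e of I
| km_f of I
| km_h of 'cV[K]_n
| km_0
| km_add of km_term & km_term
| km_scale of K & km_term
| km_br of km_term & km_term.

Local Notation root i := (intmx K (sroot S i)).

(* Equality in the auxiliary Lie algebra g~(C): the least congruence containing
   the Lie algebra axioms and the Chevalley relations. *)
Inductive km_eq : km_term -> km_term -> Prop :=
| km_refl x : km_eq x x
| km_sym x y : km_eq x y -> km_eq y x
| km_trans x y z : km_eq x y -> km_eq y z -> km_eq x z
| km_congD x x' y y' :
    km_eq x x' -> km_eq y y' -> km_eq (km_add x y) (km_add x' y')
| km_congZ a x x' : km_eq x x' -> km_eq (km_scale a x) (km_scale a x')
| km_congB x x' y y' :
    km_eq x x' -> km_eq y y' -> km_eq (km_br x y) (km_br x' y')
| km_addA x y z : km_eq (km_add x (km_add y z)) (km_add (km_add x y) z)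
| km_addC x y : km_eq (km_add x y) (km_add y x)
| km_add0 x : km_eq (km_add km_0 x) x
| km_addN x : km_eq (km_add x (km_scale (-1) x)) km_0
| km_scaleA a b x : km_eq (km_scale a (km_scale b x)) (km_scale (a * b) x)
| km_scale1 x : km_eq (km_scale 1 x) x
| km_scaleDr a x y :
    km_eq (km_scale a (km_add x y)) (km_add (km_scale a x) (km_scale a y))
| km_scaleDl a b x :
    km_eq (km_scale (a + b) x) (km_add (km_scale a x) (km_scale b x))
| km_brDl x y z : km_eq (km_br (km_add x y) z) (km_add (km_br x z) (km_br y z))
| km_brDr x y z : km_eq (km_br x (km_add y z)) (km_add (km_br x y) (km_br x z))
| km_brZl a x y : km_eq (km_br (km_scale a x) y) (km_scale a (km_br x y))
| km_brZr a x y : km_eq (km_br x (km_scale a y)) (km_scale a (km_br x y))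
| km_brxx x : km_eq (km_br x x) km_0
| km_jacobi x y z :
    km_eq (km_add (km_br x (km_br y z))
             (km_add (km_br y (km_br z x)) (km_br z (km_br x y)))) km_0
| km_hD u v : km_eq (km_h (u + v)) (km_add (km_h u) (km_h v))
| km_hZ a v : km_eq (km_h (a *: v)) (km_scale a (km_h v))
| km_ef i : km_eq (km_br (km_e i) (km_f i)) (km_h (intmx K (scoroot S i)))
| km_ef0 i j : i != j -> km_eq (km_br (km_e i) (km_f j)) km_0
| km_hh u v : km_eq (km_br (km_h u) (km_h v)) km_0
| km_he v i :
    km_eq (km_br (km_h v) (km_e i)) (km_scale (pairing (root i) v) (km_e i))
| km_hf v i :
    km_eq (km_br (km_h v) (km_f i)) (km_scale (- pairing (root i) v) (km_f i)).

Definition km_ideal (J : set km_term) : Prop :=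
  [/\ J km_0,
      forall x y, km_eq x y -> J x -> J y,
      forall x y, J x -> J y -> J (km_add x y),
      forall a x, J x -> J (km_scale a x) &
      forall x y, J y -> J (km_br x y)].

(* The largest ideal of g~(C) meeting h trivially; the Kac-Moody algebra is the
   quotient of g~(C) by it. *)
Definition km_radical : set km_term :=
  [set x | exists J, [/\ km_ideal J,
     (forall v, J (km_h v) -> km_eq (km_h v) km_0) & J x]].

Definition km_root_space (a : 'rV[K]_n) : set km_term :=
  [set x | forall v, km_radical
     (km_add (km_br (km_h v) x) (km_scale (- pairing a v) x))].

Definition km_roots : set 'rV[int]_n :=
  [set a | [/\ exists c : I -> int, a = \sum_i c i *: sroot S i,
     a <> 0 & exists2 x, km_root_space (intmx K a) x & ~ km_radical x]].

End KacMoodyAlgebra.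

Section ModelApartment.
Context (R : realType) (I : finType) (n : nat) (S : root_datum I n).

Local Notation AA := ('cV[R]_n).

Definition aroot (i : I) : 'rV[R]_n := intmx R (sroot S i).
Definition acoroot (i : I) : AA := intmx R (scoroot S i).

Definition refl_mx (i : I) : 'M[R]_n := 1%:M - acoroot i *m aroot i.

(* Products of the refl_mx i form a group, each refl_mx i being an involution. *)
Inductive weyl : 'M[R]_n -> Prop :=
| weyl1 : weyl 1%:M
| weylM i w : weyl w -> weyl (refl_mx i *m w).

Definition root_coroot (a : 'rV[R]_n) (av : AA) : Prop :=
  exists i w, [/\ weyl w, a = aroot i *m invmx w & av = w *m acoroot i].

Definition real_roots : set 'rV[R]_n := [set a | exists av, root_coroot a av].

Definition all_roots : set 'rV[R]_n := intmx R @` km_roots (complex R) S.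

Definition affmap (w : 'M[R]_n) (v : AA) : AA -> AA := fun x => w *m x + v.

Definition coroot_lattice : set AA :=
  [set q | exists c : I -> int, q = \sum_i (c i)%:~R *: acoroot i].

Definition affine_weyl : set (AA -> AA) :=
  [set g | exists w q, [/\ weyl w, coroot_lattice q & g = affmap w q]].

Definition wall (a : 'rV[R]_n) (k : R) : set AA :=
  [set x | pairing a x + k = 0].

(* None stands for k = +oo. *)
Definition half (a : 'rV[R]_n) (k : option int) : set AA :=
  if k is Some m then [set x | 0 <= pairing a x + m%:~R] else setT.
Definition open_half (a : 'rV[R]_n) (k : option int) : set AA :=
  if k is Some m then [set x | 0 < pairing a x + m%:~R] else setT.

Definition coroot_walls : set (set AA * AA) :=
  [set p | exists a av (k : int),
     root_coroot a av /\ p = (wall a k%:~R, av)].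

Definition aut_model : set (AA -> AA) :=
  [set g | exists w v, [/\ w \in unitmx, g = affmap w v &
     [set (g @` p.1, w *m p.2) | p in coroot_walls] = coroot_walls]].

(* (W^v |>< A) n Aut(A): the vectorially Weyl automorphisms. *)
Definition vweyl_aut : set (AA -> AA) :=
  [set g | exists w v, weyl w /\ g = affmap w v] `&` aut_model.

Definition std_vface (J : {set I}) : set AA :=
  [set v | (forall i, i \in J -> pairing (aroot i) v = 0) /\
           (forall i, i \notin J -> 0 < pairing (aroot i) v)].

Definition std_chamber : set AA :=
  [set v | forall i, 0 < pairing (aroot i) v].

(* A sign is a boolean, true meaning negative (as in GRing.sign). *)
Definition sgnr (s : bool) : R := (-1) ^+ s.

Definition vface (s : bool) (V : set AA) : Prop :=
  exists w J, weyl w /\ V = [set sgnr s *: (w *m v) | v in std_vface J].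

Definition vchamber (s : bool) (V : set AA) : Prop :=
  exists2 w, weyl w & V = [set sgnr s *: (w *m v) | v in std_chamber].

Definition tits_cone : set AA :=
  [set x | exists w v, [/\ weyl w, closure std_chamber v & x = w *m v]].

Definition generic_dir (v : AA) : Prop :=
  interior tits_cone v \/ interior tits_cone (- v).

Definition spherical (V : set AA) : Prop := exists2 v, V v & generic_dir v.

Definition tits_le (x y : AA) : Prop := tits_cone (y - x).

Definition segment (x y : AA) : set AA :=
  [set x + t *: (y - x) | t in [set t : R | 0 <= t <= 1]].
Definition segment_open_left (x y : AA) : set AA :=
  [set x + t *: (y - x) | t in [set t : R | 0 < t <= 1]].
Definition ray (x y : AA) : set AA :=
  [set x + t *: (y - x) | t in [set t : R | 0 <= t]].

Definition filter_add (F : set_system AA) (V : set AA) : set_system AA :=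
  [set E | exists2 E0, F E0 & [set x + v | x in E0 & v in V] `<=` E].

Definition filter_closure (F : set_system AA) : set_system AA :=
  [set E | exists2 E0, F E0 & closure E0 `<=` E].

Definition enclosure (F : set_system AA) : set_system AA :=
  [set E | exists k : 'rV[R]_n -> option int,
     let H := \bigcap_(a in all_roots) half a (k a) in F H /\ H `<=` E].

Definition affine_space (p : AA) (U : {vspace AA}) : set AA :=
  [set x | x - p \in U].

Definition is_support (F : set_system AA) (p : AA) (U : {vspace AA}) : Prop :=
  F (affine_space p U) /\
  forall p' U', F (affine_space p' U') -> affine_space p U `<=` affine_space p' U'.

Definition face (x : AA) (V : set AA) : set_system AA :=
  [set E | exists (k k' : 'rV[R]_n -> option int) (N : set AA),
     let H := \bigcap_(a in all_roots) (half a (k a) `&` open_half a (k' a)) in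
     [/\ nbhs x N, N `&` [set x + v | v in V] `<=` H & H `<=` E]].

Definition is_face (F : set_system AA) : Prop :=
  exists x s V, vface s V /\ F = face x V.

Definition is_chamber (F : set_system AA) : Prop :=
  is_face F /\ exists p U, is_support F p U /\ affine_space p U = setT.

Definition is_panel (F : set_system AA) : Prop :=
  is_face F /\ exists p U, is_support F p U /\
    exists a (k : int), real_roots a /\ affine_space p U = wall a k%:~R.

(* Germ at infinity of the sector-face x + V. *)
Definition sface_germ (x : AA) (V : set AA) : set_system AA :=
  [set E | exists2 u, closure V u & [set x + u + v | v in V] `<=` E].

Definition chimney (F : set_system AA) (V : set AA) : set_system AA :=
  enclosure (filter_add F V).

Definition chimney_germ (F : set_system AA) (V : set AA) : set_system AA :=
  [set E | exists2 u, closure V u & chimney (filter_add F [set u]) V E].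

Definition solid (r : set_system AA) : Prop :=
  exists p U, is_support r p U /\
    finite_set [set w | weyl w /\ forall u, u \in U -> w *m u = u].

Definition is_solid_chimney (r : set_system AA) : Prop :=
  exists F s V, [/\ is_face F, vface s V, r = chimney F V & solid r].

Definition is_solid_chimney_germ (g : set_system AA) : Prop :=
  exists F s V,
    [/\ is_face F, vface s V, solid (chimney F V) & g = chimney_germ F V].

Definition is_splayed_chimney_germ (g : set_system AA) : Prop :=
  exists F s V, [/\ is_face F, vface s V, spherical V & g = chimney_germ F V].

Definition is_point (F : set_system AA) : Prop :=
  exists x, F = globally [set x].

(* Both [x, y] and ]x, y] count as intervals starting at x. *)
Definition is_preordered_interval_germ (F : set_system AA) : Prop :=
  exists x y, [/\ x <> y, tits_le x y \/ tits_le y x &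
    F = within (segment x y) (nbhs x) \/
    F = within (segment_open_left x y) (nbhs x)].

Definition is_generic_ray (F : set_system AA) : Prop :=
  exists x y, [/\ x <> y, generic_dir (y - x) & F = globally (ray x y)].

Definition ma2_filter (F : set_system AA) : Prop :=
  [\/ is_point F, is_preordered_interval_germ F, is_generic_ray F
    | is_solid_chimney F].

Definition is_norm (N : AA -> R) : Prop :=
  [/\ forall x y, N (x + y) <= N x + N y,
      forall (a : R) x, N (a *: x) = `|a| * N x &
      forall x, N x = 0 -> x = 0].

End ModelApartment.

(* A set covered by subsets with charts; apt_isom A is Isom^w(AA, A). *)
Record apartment_system (R : realType) (n : nat) := ApartmentSystem {
  pts :> choiceType;
  is_apt : set (set pts);
  apt_isom : set pts -> set ('cV[R]_n -> pts)
}.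

Section Masure.
Context (R : realType) (I : finType) (n : nat) (S : root_datum I n).
Context (M : apartment_system R n).

Local Notation AA := ('cV[R]_n).

Definition contains (Z : set M) (F : set_system M) : Prop :=
  exists2 E, F E & E `<=` Z.

Definition fixes (phi : M -> M) (F : set_system M) : Prop :=
  exists2 E, F E & forall x, E x -> phi x = x.

(* Filters on AA are transported to M by fmap along a chart f; trace f goes
   back, for filters on M contained in the range of f. *)
Definition trace (f : AA -> M) (F : set_system M) : set_system AA :=
  [set E | F (f @` E)].

Definition in_apt (P : set_system AA -> Prop) (A : set M) (F : set_system M) :
  Prop := exists f F0, [/\ apt_isom A f, P F0 & F = fmap f F0].

Definition in_masure (P : set_system AA -> Prop) (F : set_system M) : Prop :=
  exists2 A, is_apt A & in_apt P A F.

Definition cl_apt (A : set M) (F : set_system M) : set_system M :=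
  [set E | exists2 f, apt_isom A f & fmap f (enclosure S (trace f F)) E].

Definition filter_union (F F' : set_system M) : set_system M :=
  [set E `|` E' | E in F & E' in F'].

(* An isomorphism A -> A' is given by a map on M, of which only the restriction
   to A matters. *)
Definition iso_in (W : set (AA -> AA)) (A A' : set M) (phi : M -> M) : Prop :=
  forall f f', apt_isom A f -> apt_isom A' f' ->
    exists2 w, W w & forall x, phi (f x) = f' (w x).

Definition weyl_iso := iso_in (affine_weyl S).
Definition apt_iso := iso_in (vweyl_aut S).

(* Isomorphisms (vectorially Weyl) from the model AA onto A. *)
Definition model_iso (A : set M) (psi : AA -> M) : Prop :=
  exists f w, [/\ apt_isom A f, vweyl_aut S w & psi = f \o w].

Definition is_apt_structure (A : set M) : Prop :=
  exists f0 : AA -> M, [/\ injective f0, range f0 = A &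
    apt_isom A = [set f0 \o w | w in affine_weyl S]].

Definition ma2_situation (A A' : set M) (F : set_system M) : Prop :=
  [/\ is_apt A, is_apt A', in_apt (ma2_filter S) A F & contains A' F].

Definition ma3_filters (Rg F : set_system M) : Prop :=
  in_masure (@is_splayed_chimney_germ R I n S) Rg /\
  (in_masure (@is_face R I n S) F \/
   in_masure (@is_solid_chimney_germ R I n S) F).

Definition ma4_situation (A A' : set M) (Rg F : set_system M) : Prop :=
  [/\ is_apt A, is_apt A', ma3_filters Rg F,
      contains A Rg /\ contains A F & contains A' Rg /\ contains A' F].

Record is_masure : Prop := IsMasure {
  masure_cover : forall x : M, exists2 A, is_apt A & A x;
  masure_MA1 : forall A : set M, is_apt A -> is_apt_structure A;
  masure_MA2 : forall A A' F, ma2_situation A A' F ->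
    contains (A `&` A') (cl_apt A F) /\
    exists2 phi, weyl_iso A A' phi & fixes phi (cl_apt A F);
  masure_MA3 : forall Rg F, ma3_filters Rg F ->
    exists A, [/\ is_apt A, contains A Rg & contains A F];
  masure_MA4 : forall A A' Rg F, ma4_situation A A' Rg F ->
    exists2 phi, weyl_iso A A' phi & fixes phi (cl_apt A (filter_union Rg F));
  masure_MAO : forall (A A' : set M) f f' a b a' b',
    is_apt A -> is_apt A' -> apt_isom A f -> apt_isom A' f' ->
    f a = f' a' -> f b = f' b' -> tits_le S a b ->
    f @` segment a b = f' @` segment a' b'
}.

Definition adjacent_chambers (P : set_system M) : set (set_system M) :=
  [set C | exists A f F0 C0, [/\ is_apt A, apt_isom A f, is_chamber S C0,
     P = fmap f F0 /\ C = fmap f C0 & filter_closure C0 `<=` F0]].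

Definition thick_locally_finite : Prop :=
  forall P, in_masure (@is_panel R I n S) P ->
    finite_set (adjacent_chambers P) /\ (`I_3 #<= adjacent_chambers P)%card.

Record strongly_transitive (G : groupType) (act : G -> M -> M) : Prop :=
  StronglyTransitive {
  st_act1 : forall x, act 1%g x = x;
  st_actM : forall g h x, act (g * h)%g x = act g (act h x);
  st_apt : forall g A, is_apt A -> is_apt (act g @` A);
  st_iso : forall g A, is_apt A -> apt_iso A (act g @` A) (act g);
  st_MA2 : forall A A' F phi, ma2_situation A A' F ->
    weyl_iso A A' phi -> fixes phi (cl_apt A F) ->
    exists g, forall x, A x -> act g x = phi x;
  st_MA4 : forall A A' Rg F phi, ma4_situation A A' Rg F ->
    weyl_iso A A' phi -> fixes phi (cl_apt A (filter_union Rg F)) ->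
    exists g, forall x, A x -> act g x = phi x
}.

(* AA is identified with the apartment A0 through the chart f0, and the
   stabilizer of A0 induces on it the group W^v |>< Y. *)
Definition model_stabilizer (G : groupType) (act : G -> M -> M)
    (A0 : set M) (f0 : AA -> M) : Prop :=
  [set phi : AA -> AA | exists g, act g @` A0 = A0 /\
     forall x, act g (f0 x) = f0 (phi x)] =
  [set phi | exists w (y : 'cV[int]_n),
     weyl S w /\ phi = affmap w (intmx R y)].

Definition sector_germ (s : bool) (g : set_system M) : Prop :=
  in_masure (fun F => exists x V, vchamber S s V /\ F = sface_germ x V) g.

Definition model_infty (s : bool) : set_system AA :=
  sface_germ 0 [set sgnr R s *: v | v in std_chamber S].

(* x +_g u for g of sign s; the value does not depend on A1 and psi. *)
Definition splus (s : bool) (g : set_system M) (x : M) (u : AA) : M :=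
  xget x [set y | exists A1 psi p,
    [/\ is_apt A1, A1 x /\ contains A1 g,
        model_iso A1 psi /\ fmap psi (model_infty s) = g,
        psi p = x & y = psi (p + sgnr R s *: u)]].

Definition meeting (s : bool) (g : set_system M) (x x' : M) : set (AA * AA) :=
  [set uu | [/\ closure (std_chamber S) uu.1, closure (std_chamber S) uu.2 &
     splus s g x uu.1 = splus s g x' uu.2]].

Record theta (s : bool) := Theta {
  theta_norm : AA -> R;
  theta_germ : set_system M;
  theta_normP : is_norm theta_norm;
  theta_germP : sector_germ s theta_germ
}.

Definition dist (s : bool) (t : theta s) (x x' : M) : R :=
  inf [set theta_norm t uu.1 + theta_norm t uu.2
      | uu in meeting s (theta_germ t) x x'].

End Masure.

(* Main.v *)
Require Import Defs.
From mathcomp Require Import all_boot all_order all_algebra.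
From mathcomp Require Import all_classical all_reals all_analysis.
From mathcomp Require Import complex ring lra zify.

(** It suffices to compare the distances of two positive sector germs s, s' for
    one norm. As x +_s u = x' +_s u' for every (u, u') in U_s(x, x'), the
    triangle inequality reduces this to d_s'(x, x +_s u) <= C |u|. Two positive
    sector germs lie in a common apartment, where they are joined by a gallery,
    so s and s' may be assumed adjacent, along a panel of type i.

    The flows of s and s' agree in the directions of that panel: both are the
    flow towards the panel germ at infinity based at b, for two different b, and
    this flow is locally constant, hence constant, along a segment of points b.
    Now cut the segment from x to x +_s u into pieces each lying in an apartment
    containing s'. There the piece has direction w u, w in W^v. Adding a large
    panel direction v, common to both flows, gives w u + v in W^v (u + v); since
    w u + v or r_i (w u + v) is dominant and W^v-orbits contain at most one
    dominant vector, w u is u or r_i u. So each piece has d_s'-length at most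
    C |u| times its length. *)

Set Implicit Arguments.
Unset Strict Implicit.
Unset Printing Implicit Defensive.

Import Order.TTheory GRing.Theory Num.Theory.
Import numFieldNormedType.Exports.
Local Open Scope classical_set_scope.
Local Open Scope ring_scope.

(** * Dominant vectors and the Weyl group *)

(** A point and two adjacent germs need not lie in a common apartment: moved towards one germ, [x]
    may leave every apartment that contains the other. The directions of the common panel are what
    can be compared directly, and they suffice to control [w u].

    Enclosures are cut out by all roots of the Kac-Moody algebra. A cone is recognized as enclosed
    once the roots that bound it are known to be such roots; for chambers and panels these are the
    simple roots and their opposites, whence the detour through the algebra. Enclosed sets then act
    through their closedness, their recession directions, and their invariance under vectors killed
    by all simple roots.

    The axioms give apartments containing germs, with no control on the size of the pieces. Local
    statements are therefore glued by real induction, once for the constancy of the panel flow and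
    once for the length bound. The constants depend on the norm and on the type of the panel, not on
    the germ, so they multiply along a gallery. *)

Section Pairing.
Context (K : comPzRingType) (n : nat).
Implicit Types (a : 'rV[K]_n) (x y : 'cV[K]_n).

Lemma pairingD a x y : pairing a (x + y) = pairing a x + pairing a y.
Proof. by rewrite /pairing mulmxDr mxE. Qed.

Lemma pairingZ a t x : pairing a (t *: x) = t * pairing a x.
Proof. by rewrite /pairing -scalemxAr mxE. Qed.

Lemma pairingN a x : pairing a (- x) = - pairing a x.
Proof. by rewrite /pairing mulmxN mxE. Qed.

Lemma pairingNl a x : pairing (- a) x = - pairing a x.
Proof. by rewrite /pairing mulNmx [LHS]mxE. Qed.

Lemma pairingB a x y : pairing a (x - y) = pairing a x - pairing a y.
Proof. by rewrite pairingD pairingN. Qed.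

Lemma pairing0 a : pairing a 0 = 0.
Proof. by rewrite /pairing mulmx0 mxE. Qed.

Lemma pairingE a x : pairing a x = \sum_j a 0 j * x j 0.
Proof. by rewrite /pairing mxE. Qed.

Lemma pairing_suml (J : finType) (c : J -> K) (b : J -> 'rV[K]_n) x :
  pairing (\sum_j c j *: b j) x = \sum_j c j * pairing (b j) x.
Proof.
rewrite /pairing mulmx_suml summxE; apply: eq_bigr => j _.
by rewrite -scalemxAl mxE.
Qed.

End Pairing.

Section Weyl.
Context (R : realType) (I : finType) (n : nat) (S : root_datum I n).
Local Notation AA := 'cV[R]_n.
Local Notation al i x := (pairing (aroot R S i) x).
Local Notation co i := (acoroot R S i).
Local Notation c i j := ((cartan S i j)%:~R : R).
Local Notation r i := (refl_mx R S i).
Implicit Types (i j : I) (u v x : AA) (w : 'M[R]_n).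

Lemma refl_mxE i x : r i *m x = x - al i x *: co i.
Proof.
rewrite /refl_mx mulmxBl mul1mx -mulmxA; congr (_ - _).
by rewrite [aroot R S i *m x]mx11_scalar mul_mx_scalar.
Qed.

Lemma aroot_acoroot i j : al j (co i) = c i j.
Proof.
rewrite -sroot_scoroot /pairing /aroot /acoroot /intmx.
by rewrite -(@map_mxM _ _ (intr : int -> R)) mxE.
Qed.

Lemma aroot_refl i j x : al i (r j *m x) = al i x - al j x * c j i.
Proof. by rewrite refl_mxE pairingB pairingZ aroot_acoroot. Qed.

Lemma aroot_refl_diag i x : al i (r i *m x) = - al i x.
Proof. by rewrite aroot_refl cartan_diag; lra. Qed.

Lemma reflK i x : r i *m (r i *m x) = x.
Proof.
rewrite refl_mxE aroot_refl_diag refl_mxE.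
by apply/matrixP => k l; rewrite !mxE; ring.
Qed.

Lemma mulmx_cV_inj w w' : (forall x, w *m x = w' *m x) -> w = w'.
Proof.
move=> e; apply/matrixP => k l; have := e (delta_mx l 0).
by rewrite -!colE => /matrixP /(_ k 0); rewrite !mxE.
Qed.

Lemma refl_mx_sqr i : r i *m r i = 1%:M.
Proof. by apply: mulmx_cV_inj => x; rewrite -mulmxA reflK mul1mx. Qed.

Lemma weyl_mul w w' : weyl S w -> weyl S w' -> weyl S (w *m w').
Proof.
move=> + ww'; elim=> [|i w0 _ IH]; first by rewrite mul1mx.
by rewrite -mulmxA; exact: weylM.
Qed.

Lemma weyl_refl i : weyl S (r i).
Proof. by rewrite -(mulmx1 (r i)); apply: weylM; exact: weyl1. Qed.

Lemma weyl_inv w : weyl S w -> exists2 w', weyl S w' & w' *m w = 1%:M /\ w *m w' = 1%:M.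
Proof.
elim=> [|i w0 _ [w' ww' [e1 e2]]]; first by exists 1%:M; [exact: weyl1|rewrite mulmx1].
exists (w' *m r i); first by apply: weyl_mul => //; exact: weyl_refl.
split; first by rewrite -mulmxA (mulmxA (r i)) refl_mx_sqr mul1mx.
by rewrite -mulmxA (mulmxA w0) e2 mul1mx refl_mx_sqr.
Qed.

Definition dominant x := forall i, 0 <= al i x.

(* Mozes' numbers game; its confluence makes the dominant vector of an orbit
   unique. *)
Inductive fires : nat -> AA -> AA -> Prop :=
| fires0 v : dominant v -> fires 0 v v
| firesS k i u v : al i u < 0 -> fires k (r i *m u) v -> fires k.+1 u v.

(** Strong convergence: any legal first move starts a game with the same end and the same length.
    Keeping the length is what allows induction on it. *)
Definition fires_confluent k := forall u v, fires k u v ->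
  forall i, al i u < 0 -> exists2 k', k = k'.+1 & fires k' (r i *m u) v.

Lemma cartan_le0 i j : i != j -> c i j <= 0.
Proof. by move=> /(cartan_offdiag S) h; rewrite -(@ler_int R) in h. Qed.

(* If [c i j * c j i >= 4] the game restricted to the nodes [i] and [j] never
   stops, as the condition [2 * al i u <= c j i * al j u] propagates. *)
Lemma rank2_infinite k i j : i != j -> 4 <= c i j * c j i ->
  (forall k', (k' <= k)%N -> fires_confluent k') ->
  forall u v, al j u < 0 -> 2 * al i u <= c j i * al j u -> fires k u v -> False.
Proof.
move=> + + conf; elim: k => [|k IH] in i j conf *.
  by move=> ij c4 u v uj _ uv; have [//|k'] := conf _ _ _ _ uv _ uj.
move=> ij c4 u v uj ui uv; have [//|k' [ek] uv'] := conf _ _ _ _ uv _ uj.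
have cij : c i j <= 0 by exact: cartan_le0.
have cji : c j i <= 0 by apply: cartan_le0; rewrite eq_sym.
subst k'; have {}IH := IH j i (fun k' lek => conf k' (leqW lek)).
apply: IH uv' => //; rewrite ?aroot_refl_diag ?aroot_refl.
- by rewrite eq_sym.
- by rewrite mulrC.
- nra.
- nra.
Qed.

(** Firing [i] and [j] moves [u] in the directions of two coroots; in these coordinates the braid
    relations become polynomial identities in [al i u] and [al j u]. *)
Lemma rank2_coords i j u a b :
  r i *m (u - a *: co i - b *: co j) =
  u - (al i u - a - b * c j i) *: co i - b *: co j.
Proof.
rewrite refl_mxE !pairingB !pairingZ !aroot_acoroot cartan_diag.
by apply/matrixP => k l; rewrite !mxE; ring.
Qed.

Lemma rank2_coords' i j u a b :
  r j *m (u - a *: co i - b *: co j) =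
  u - a *: co i - (al j u - b - a * c i j) *: co j.
Proof. by rewrite addrAC rank2_coords addrAC. Qed.

Lemma rank2_base i j u : u = u - 0 *: co i - 0 *: co j.
Proof. by rewrite !scale0r !subr0. Qed.

Lemma rank2_coords_eq i j u a b a' b' : a = a' -> b = b' ->
  u - a *: co i - b *: co j = u - a' *: co i - b' *: co j.
Proof. by move=> -> ->. Qed.

(** [rank2_fwd] plays a move in the hypothesis by the induction hypothesis, [rank2_bwd] plays one in
    the goal, and [rank2_word] identifies the two positions reached. *)
Ltac rank2_neg cii cjj e1 e2 :=
  match goal with ui : is_true (pairing _ _ < 0), uj : is_true (pairing _ _ < 0) |- _ =>
  rewrite !aroot_refl ?cii ?cjj ?e1 ?e2; move: ui uj; clear; lra end.
Ltac rank2_fwd H a IH cii cjj e1 e2 :=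
  let k := fresh "k" in let ek := fresh "ek" in
  case: (IH _ _ a H);
    [by rewrite ?leqW|by rank2_neg cii cjj e1 e2 | move=> k ek {}H; subst].
Ltac rank2_bwd a cii cjj e1 e2 := refine (@firesS _ a _ _ _ _);
  first by rank2_neg cii cjj e1 e2.
Ltac rank2_word H i j u e1 e2 :=
  match type of H with fires _ ?a _ => match goal with |- fires _ ?b _ =>
    have -> : b = a; [|exact: H] end end;
  rewrite (rank2_base i j u); move: (rank2_coords i j u) (rank2_coords' i j u);
  rewrite e1 e2; clear; move: (al i u) (al j u) (mulmx (r i)) (mulmx (r j)) => x y ri rj;
  let ei := fresh in let ej := fresh in move=> ei ej;
  rewrite !(ei, ej); apply: rank2_coords_eq; ring.

(** If the game begins with another node [j], then [i] and [j] are both negative at [u]; playing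
    them alternately from either one leads to the same position, by the braid relation of the finite
    dihedral group generated by [r i] and [r j]. *)
Lemma fires_confluent_all k : fires_confluent k.
Proof.
elim/ltn_ind: k => k IH u v uv i ui.
case: uv ui IH => [{}v /(_ i) vi|{}k j {}u {}v uj uv] ui IH; first by lra.
have [ij|ij] := eqVneq i j; first by subst j; exists k.
have conf k' : (k' <= k)%N -> fires_confluent k' by move=> h; apply: IH.
have cij : c i j <= 0 by exact: cartan_le0.
have cji : c j i <= 0 by apply: cartan_le0; rewrite eq_sym.
have cii : c i i = 2 by rewrite cartan_diag.
have cjj : c j j = 2 by rewrite cartan_diag.
have [c4|c4] := lerP 4 (c i j * c j i).
  exfalso; apply: (rank2_infinite (k := k) (i := j) (j := i) _ _ conf _ _ uv).
  - by rewrite eq_sym.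
  - by rewrite mulrC.
  - rewrite aroot_refl; nra.
  - rewrite aroot_refl_diag aroot_refl; nra.
(* The rank two types of finite kind: A1 x A1, A2, B2 and G2. *)
have cases : [\/ [/\ c i j = 0 & c j i = 0], [/\ c i j = -1 & c j i = -1],
    [/\ c i j = -1 & c j i = -2] \/ [/\ c i j = -2 & c j i = -1] |
    [/\ c i j = -1 & c j i = -3] \/ [/\ c i j = -3 & c j i = -1]].
  have c0 := cartan_eq0 S i j.
  move: c4 cij cji c0; rewrite -intrM (@ltr_int R _ 4) !lerz0.
  move: (cartan S i j) (cartan S j i) => p q pq p0 q0 pq0.
  have [[-> ->]|[[-> ->]|[[-> ->]|[[-> ->]|[[-> ->]|[-> ->]]]]]] :
    (p = 0 /\ q = 0) \/ (p = -1 /\ q = -1) \/ (p = -1 /\ q = -2) \/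
    (p = -2 /\ q = -1) \/ (p = -1 /\ q = -3) \/ (p = -3 /\ q = -1).
  have [p00|p00] := eqVneq p 0; first by left; split=> //; apply/pq0.
  have [q00|q00] := eqVneq q 0; first by left; split=> //; apply/pq0.
  right; have : -3 <= p by nia. have : -3 <= q by nia. nia.
  - by constructor 1.
  - by constructor 2.
  - by constructor 3; left.
  - by constructor 3; right.
  - by constructor 4; left.
  - by constructor 4; right.
have {}IH k' u' a (h : fires k' u' v) (lek : (k' <= k)%N) (neg : al a u' < 0) :
  exists2 k'', k' = k''.+1 & fires k'' (r a *m u') v by exact: conf h _ neg.
clear c4 conf.
(* With m = 2, 3, 4, 6 the order of [r i *m r j], the moves [j] (already played) and [i] are each
   completed by m - 1 alternating moves. *)
case: cases => [[e1 e2]|[e1 e2]|[] [e1 e2]|[] [e1 e2]].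
- rank2_fwd uv i IH cii cjj e1 e2.
  refine (ex_intro2 _ _ _ erefl _).
  rank2_bwd j cii cjj e1 e2.
  rank2_word uv i j u e1 e2.
- rank2_fwd uv i IH cii cjj e1 e2. rank2_fwd uv j IH cii cjj e1 e2.
  refine (ex_intro2 _ _ _ erefl _).
  rank2_bwd j cii cjj e1 e2. rank2_bwd i cii cjj e1 e2.
  rank2_word uv i j u e1 e2.
- rank2_fwd uv i IH cii cjj e1 e2. rank2_fwd uv j IH cii cjj e1 e2.
  rank2_fwd uv i IH cii cjj e1 e2.
  refine (ex_intro2 _ _ _ erefl _).
  rank2_bwd j cii cjj e1 e2. rank2_bwd i cii cjj e1 e2. rank2_bwd j cii cjj e1 e2.
  rank2_word uv i j u e1 e2.
- rank2_fwd uv i IH cii cjj e1 e2. rank2_fwd uv j IH cii cjj e1 e2.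
  rank2_fwd uv i IH cii cjj e1 e2.
  refine (ex_intro2 _ _ _ erefl _).
  rank2_bwd j cii cjj e1 e2. rank2_bwd i cii cjj e1 e2. rank2_bwd j cii cjj e1 e2.
  rank2_word uv i j u e1 e2.
- rank2_fwd uv i IH cii cjj e1 e2. rank2_fwd uv j IH cii cjj e1 e2.
  rank2_fwd uv i IH cii cjj e1 e2. rank2_fwd uv j IH cii cjj e1 e2.
  rank2_fwd uv i IH cii cjj e1 e2.
  refine (ex_intro2 _ _ _ erefl _).
  rank2_bwd j cii cjj e1 e2. rank2_bwd i cii cjj e1 e2.
  rank2_bwd j cii cjj e1 e2. rank2_bwd i cii cjj e1 e2.
  rank2_bwd j cii cjj e1 e2.
  rank2_word uv i j u e1 e2.
- rank2_fwd uv i IH cii cjj e1 e2. rank2_fwd uv j IH cii cjj e1 e2.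
  rank2_fwd uv i IH cii cjj e1 e2. rank2_fwd uv j IH cii cjj e1 e2.
  rank2_fwd uv i IH cii cjj e1 e2.
  refine (ex_intro2 _ _ _ erefl _).
  rank2_bwd j cii cjj e1 e2. rank2_bwd i cii cjj e1 e2.
  rank2_bwd j cii cjj e1 e2. rank2_bwd i cii cjj e1 e2.
  rank2_bwd j cii cjj e1 e2.
  rank2_word uv i j u e1 e2.
Qed.

(** Applying [r i] to a position plays a legal move, undoes one, or does nothing, according to the
    sign of [al i]. *)
Lemma fires_orbit v w : dominant v -> weyl S w -> exists k, fires k (w *m v) v.
Proof.
move=> vd; elim=> [|i w0 ww0 [k IH]].
  by exists 0; rewrite mul1mx; exact: fires0.
rewrite -mulmxA; set u := w0 *m v in IH *.
have [ui|ui|ui] := ltrgtP (al i u) 0.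
- by have [k' _] := fires_confluent_all IH ui; exists k'.
- exists k.+1; apply: (firesS (i := i)); last by rewrite reflK.
  by rewrite aroot_refl_diag oppr_lt0.
- by exists k; rewrite refl_mxE ui scale0r subr0.
Qed.

(** No move is legal at a dominant position, so the game from [w *m v] to [v] has length 0. *)
Lemma dominant_orbit_eq v w : dominant v -> weyl S w -> dominant (w *m v) -> w *m v = v.
Proof.
move=> vd ww wvd; have [k f] := fires_orbit vd ww.
move: (w *m v) wvd f => x + f; case: f => // k' i u v' ui _ /(_ i).
by rewrite leNgt ui.
Qed.

End Weyl.

(** * Simple roots are roots of the Kac-Moody algebra *)

Section SimpleRoots.
Context (K : numFieldType) (I : finType) (n : nat) (S : root_datum I n).
Local Notation root i := (intmx K (sroot S i)).
Local Notation coroot i := (intmx K (scoroot S i)).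
Local Notation term := (km_term K I n).
Implicit Types (x y z : term) (phi psi : seq I -> K) (w : seq I).

(* The transpose of the action of the auxiliary Lie algebra on the Verma-like
   module with basis the words in the f_i and highest weight lam; transposing
   reverses the order of products. *)
Section Verma.
Context (lam : 'rV[K]_n).

Definition verma_weight w (v : 'cV[K]_n) : K :=
  pairing lam v - \sum_(i <- w) pairing (root i) v.

(** Evaluates [phi] on e_j f_i w', rewritten as f_i e_j w' + [e_j, f_i] w'. The highest weight
    vector, the empty word, is killed by e_j. *)
Fixpoint verma_e (j : I) phi w : K :=
  if w is i :: w' then
    verma_e j (fun w0 => phi (i :: w0)) w' +
      (if i == j then verma_weight w' (coroot j) * phi w' else 0)
  else 0.

Fixpoint verma_op x phi w : K :=
  match x with
  | km_e j => verma_e j phi w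
  | km_f j => phi (j :: w)
  | km_h v => verma_weight w v * phi w
  | km_0 => 0
  | km_add x y => verma_op x phi w + verma_op y phi w
  | km_scale a x => a * verma_op x phi w
  | km_br x y =>
      verma_op y (verma_op x phi) w - verma_op x (verma_op y phi) w
  end.

Lemma verma_e_linear j a phi psi w :
  verma_e j (fun w0 => a * phi w0 + psi w0) w =
  a * verma_e j phi w + verma_e j psi w.
Proof.
elim: w phi psi => [|i w IH] phi psi /=; first by rewrite mulr0 addr0.
by rewrite (IH (fun w0 => phi (i :: w0))); case: eqP => _; ring.
Qed.

Lemma verma_op_linear x a phi psi :
  verma_op x (fun w => a * phi w + psi w) =
  (fun w => a * verma_op x phi w + verma_op x psi w).
Proof.
elim: x a phi psi => [j|j|v||x IHx y IHy|b x IHx|x IHx y IHy] a phi psi;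
  apply/funext => w /=.
- exact: verma_e_linear.
- by [].
- by ring.
- by rewrite mulr0 addr0.
- by rewrite IHx IHy; ring.
- by rewrite IHx; ring.
- by rewrite !(IHx, IHy); ring.
Qed.

Lemma verma_opZ x a phi :
  verma_op x (fun w => a * phi w) = (fun w => a * verma_op x phi w).
Proof.
have z : verma_op x (fun=> 0) = (fun=> 0).
  have := verma_op_linear x (-1) (fun=> 0) (fun=> 0).
  rewrite (_ : (fun=> _) = (fun=> 0 : K)); last by apply/funext=> w; ring.
  by move/funeqP => e; apply/funext => w; rewrite e /=; ring.
have := verma_op_linear x a phi (fun=> 0); rewrite z.
rewrite (_ : (fun w => _ + 0) = (fun w => a * phi w)); last by apply/funext=> w; ring.
by move=> ->; apply/funext=> w; ring.
Qed.

Lemma verma_opD x phi psi :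
  verma_op x (fun w => phi w + psi w) = (fun w => verma_op x phi w + verma_op x psi w).
Proof.
have := verma_op_linear x 1 phi psi.
rewrite (_ : (fun w => 1 * phi w + _) = (fun w => phi w + psi w)).
  by move=> ->; apply/funext => w; rewrite mul1r.
by apply/funext => w; rewrite mul1r.
Qed.

Lemma verma_opB x phi psi :
  verma_op x (fun w => phi w - psi w) = (fun w => verma_op x phi w - verma_op x psi w).
Proof.
have := verma_op_linear x (-1) psi phi.
rewrite (_ : (fun w => -1 * psi w + _) = (fun w => phi w - psi w)).
  by move=> ->; apply/funext => w; rewrite mulN1r addrC.
by apply/funext => w; rewrite mulN1r addrC.
Qed.

Lemma verma_weight_cons i w v :
  verma_weight (i :: w) v = verma_weight w v - pairing (root i) v.
Proof. by rewrite /verma_weight big_cons; ring. Qed.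

(** The constant [a] is there for the induction: each letter [i] passed shifts it by
    [- pairing (root i) v]. *)
Lemma verma_eh j v a phi w :
  verma_e j (fun w0 => (verma_weight w0 v + a) * phi w0) w =
  (verma_weight w v + a + pairing (root j) v) * verma_e j phi w.
Proof.
elim: w a phi => [|i w IH] a phi; first by rewrite /= mulr0.
rewrite /= !verma_weight_cons.
rewrite (_ : (fun w0 => _) = fun w0 =>
    (verma_weight w0 v + (a - pairing (root i) v)) * phi (i :: w0)); last first.
  by apply/funext => w0; rewrite verma_weight_cons; ring.
by rewrite (IH _ (fun w0 => phi (i :: w0))); case: eqP => [->|_]; ring.
Qed.

Lemma verma_op_sound x y : km_eq S x y -> verma_op x = verma_op y.
Proof.
have ext (f g : (seq I -> K) -> seq I -> K) : (forall phi w, f phi w = g phi w) -> f = g.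
  by move=> fg; apply/funext => phi; apply/funext => w.
elim=> {x y}.
- by [].
- by move=> x y _ ->.
- by move=> x y z _ -> _ ->.
- by move=> x x' y y' _ IHx _ IHy; apply: ext => phi w /=; rewrite IHx IHy.
- by move=> a x x' _ IHx; apply: ext => phi w /=; rewrite IHx.
- by move=> x x' y y' _ IHx _ IHy; apply: ext => phi w /=; rewrite IHx IHy.
- by move=> x y z; apply: ext => phi w /=; ring.
- by move=> x y; apply: ext => phi w /=; ring.
- by move=> x; apply: ext => phi w /=; ring.
- by move=> x; apply: ext => phi w /=; ring.
- by move=> a b x; apply: ext => phi w /=; ring.
- by move=> x; apply: ext => phi w /=; ring.
- by move=> a x y; apply: ext => phi w /=; ring.
- by move=> a b x; apply: ext => phi w /=; ring.
- by move=> x y z; apply: ext => phi w /=; rewrite verma_opD; ring.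
- by move=> x y z; apply: ext => phi w /=; rewrite verma_opD; ring.
- by move=> a x y; apply: ext => phi w /=; rewrite verma_opZ; ring.
- by move=> a x y; apply: ext => phi w /=; rewrite verma_opZ; ring.
- by move=> x; apply: ext => phi w /=; ring.
- by move=> x y z; apply: ext => phi w /=; rewrite !verma_opB; ring.
- move=> u v; apply: ext => phi w /=; rewrite /verma_weight pairingD.
  under eq_bigr do rewrite pairingD.
  by rewrite big_split /=; ring.
- move=> a v; apply: ext => phi w /=; rewrite /verma_weight pairingZ.
  under eq_bigr do rewrite pairingZ.
  by rewrite -mulr_sumr; ring.
- by move=> i; apply: ext => phi w /=; rewrite eqxx; ring.
- by move=> i j ij; apply: ext => phi w /=; rewrite eq_sym (negPf ij); ring.
- by move=> u v; apply: ext => phi w /=; ring.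
- move=> v i; apply: ext => phi w /=.
  have := verma_eh i v 0 phi w; under eq_fun do rewrite addr0.
  by move=> ->; ring.
- by move=> v i; apply: ext => phi w /=; rewrite verma_weight_cons; ring.
Qed.

End Verma.

(** With highest weight [root i], the coroot acts on the highest weight vector by 2, which is
    nonzero in characteristic 0. *)
Lemma km_h_coroot_neq0 i : ~ km_eq S (km_h I (coroot i)) (km_0 K I n).
Proof.
move=> /(verma_op_sound (root i)) /funeqP /(_ (fun=> 1)) /funeqP /(_ [::]) /=.
rewrite /verma_weight big_nil subr0 mulr1 /pairing /intmx.
rewrite -(@map_mxM _ _ (intr : int -> K)) mxE sroot_scoroot cartan_diag.
by apply/eqP; rewrite pnatr_eq0.
Qed.

Lemma km_br_anti x y : km_eq S (km_add (km_br x y) (km_br y x)) (km_0 _ _ _).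
Proof.
apply: km_sym; apply: km_trans (km_sym (km_brxx _ (km_add x y))) _.
apply: km_trans (km_brDl _ _ _ _) _; apply: km_congD.
  apply: km_trans (km_brDr _ _ _ _) _.
  apply: km_trans (km_congD (km_brxx _ _) (km_refl _ _)) _.
  exact: km_add0.
apply: km_trans (km_brDr _ _ _ _) _.
apply: km_trans (km_congD (km_refl _ _) (km_brxx _ _)) _.
apply: km_trans (km_addC _ _ _) _; exact: km_add0.
Qed.

Lemma km_ideal_coroot i (J : set term) : km_ideal S J ->
  (forall v, J (km_h I v) -> km_eq S (km_h I v) (km_0 _ _ _)) ->
  ~ J (km_br (km_e K n i) (km_f K n i)).
Proof.
move=> [J0 Jeq _ _ _] Jh Jb; apply: (km_h_coroot_neq0 (i := i)); apply: Jh.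
by apply: Jeq Jb; exact: km_ef.
Qed.

(** An ideal containing e_i contains [f_i, e_i], since [km_ideal] allows brackets on the left;
    antisymmetry turns this into the coroot [e_i, f_i]. *)
Lemma km_e_notin_radical i : ~ km_radical S (km_e K n i).
Proof.
move=> [J [idJ Jh Je]]; apply: (km_ideal_coroot (i := i) idJ Jh).
have [J0 Jeq JD JZ Jbr] := idJ.
set e := km_e K n i; set f := km_f K n i.
have Jfe : J (km_br f e) by exact: Jbr.
have Js : J (km_add (km_br f e) (km_br e f)).
  by apply: Jeq J0; exact: km_sym (km_br_anti _ _).
apply: Jeq (JD _ _ Js (JZ (-1) _ Jfe)).
apply: km_trans (km_addC _ _ _) _; apply: km_trans (km_addA _ _ _ _) _.
apply: km_trans (km_congD _ (km_refl _ _)) (km_add0 _ _).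
apply: km_trans (km_addC _ _ _) _; exact: km_addN.
Qed.

Lemma km_f_notin_radical i : ~ km_radical S (km_f K n i).
Proof.
move=> [J [idJ Jh Jf]]; apply: (km_ideal_coroot (i := i) idJ Jh).
by have [_ _ _ _ Jbr] := idJ; exact: Jbr.
Qed.

Lemma km_radical_eq0 x : km_eq S x (km_0 _ _ _) -> km_radical S x.
Proof.
move=> x0; exists [set y | km_eq S y (km_0 _ _ _)]; split=> //.
have br0 y : km_eq S (km_br y (km_0 _ _ _)) (km_0 K I n).
  apply: km_trans (km_congB (km_refl _ _) (km_sym (km_addN _ (km_0 _ _ _)))) _.
  apply: km_trans (km_brDr _ _ _ _) _.
  apply: km_trans (km_congD (km_refl _ _) (km_brZr _ _ _ _)) _.
  exact: km_addN.
have sc0 a : km_eq S (km_scale a (km_0 _ _ _)) (km_0 K I n).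
  apply: km_trans (km_congZ _ (km_sym (km_addN _ (km_0 _ _ _)))) _.
  apply: km_trans (km_scaleDr _ _ _ _) _.
  apply: km_trans (km_congD (km_refl _ _) (km_scaleA _ _ _ _)) _.
  rewrite mulrC; apply: km_trans (km_congD (km_refl _ _) (km_sym (km_scaleA _ _ _ _))) _.
  exact: km_addN.
split=> /=.
- exact: km_refl.
- by move=> u v uv u0; exact: km_trans (km_sym uv) u0.
- by move=> u v u0 v0; apply: km_trans (km_congD u0 v0) _; exact: km_add0.
- by move=> a u u0; apply: km_trans (km_congZ _ u0) _.
- by move=> u v v0; apply: km_trans (km_congB (km_refl _ _) v0) _.
Qed.

Lemma sroot_neq0 i : sroot S i <> 0.
Proof.
move=> e; have h := sroot_free (r := S) (c := fun j => (j == i)%:Z).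
suff /h/(_ i) : \sum_j (j == i)%:Z *: sroot S j = 0 by rewrite eqxx.
by rewrite big1 // => j _; case: eqP => [->|_]; rewrite ?e ?scaler0 ?scale0r.
Qed.

Lemma sum_delta i (c : int) :
  \sum_j (if j == i then c else 0) *: sroot S j = c *: sroot S i.
Proof.
by rewrite (bigD1 i) //= eqxx big1 ?addr0 // => j /negPf ->; rewrite scale0r.
Qed.

Lemma km_roots_sroot i : km_roots K S (sroot S i).
Proof.
split; first by exists (fun j => if j == i then 1 else 0); rewrite sum_delta scale1r.
  exact: sroot_neq0.
exists (km_e K n i); last exact: km_e_notin_radical.
move=> v; apply: km_radical_eq0.
apply: km_trans (km_congD (km_he _ _ _) (km_refl _ _)) _.
apply: km_trans (km_addN _ (km_scale (pairing (root i) v) (km_e K n i))).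
by rewrite -mulN1r; apply: km_congD (km_refl _ _) (km_sym (km_scaleA _ _ _ _)).
Qed.

Lemma km_roots_Nsroot i : km_roots K S (- sroot S i).
Proof.
split; first by exists (fun j => if j == i then -1 else 0); rewrite sum_delta scaleN1r.
  by move=> /eqP; rewrite oppr_eq0 => /eqP; exact: sroot_neq0.
exists (km_f K n i); last exact: km_f_notin_radical.
move=> v; apply: km_radical_eq0.
apply: km_trans (km_congD (km_hf _ _ _) (km_refl _ _)) _.
have -> : pairing (intmx K (- sroot S i)) v = - pairing (root i) v.
  by rewrite /pairing /intmx map_mxN mulNmx mxE.
set b := - pairing _ v; rewrite -mulN1r.
apply: km_trans (km_congD (km_refl _ _) (km_sym (km_scaleA _ _ _ _))) _.
exact: km_addN.
Qed.

End SimpleRoots.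

(** * Geometry of the model apartment *)

Section Geometry.
Context (R : realType) (I : finType) (n : nat) (S : root_datum I n).
Local Notation AA := 'cV[R]_n.
Local Notation al i x := (pairing (aroot R S i) x).
(* ssrnat's half shadows the one of Defs. *)
Local Notation half := Defs.half.
Implicit Types (i j : I) (a : 'rV[R]_n) (u v x z : AA).

(** Independence over the integers gives independence over the rationals by clearing denominators,
    then over [R] because the rank is invariant under field extension; a matrix with free rows has a
    right inverse. *)
Lemma aroot_surj (val : I -> R) : exists z : AA, forall i, al i z = val i.
Proof.
pose A : 'M[int]_(#|I|, n) := \matrix_(k, l) sroot S (enum_val k) 0 l.
have freeQ : row_free (map_mx (intr : int -> rat) A).
  rewrite -kermx_eq0; apply/rowV0P => v /sub_kermxP vA.
  (* The row [v] is read as a polynomial so as to obtain a common denominator [d] of its entries. *)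
  have [q [d d0 eq]] := rat_poly_scale (rVpoly v).
  have vq k : v 0 k = d%:~R^-1 * (q`_k)%:~R.
    by rewrite -(@coef_rVpoly_ord _ #|I|) eq coefZ coef_map.
  have d0' : (d%:~R : rat)^-1 != 0 by rewrite invr_eq0 intr_eq0.
  suff qz (i : I) : q`_(enum_rank i) = 0.
    apply/rowP => k; rewrite vq !mxE -(enum_valK k) qz.
    by rewrite mulr0.
  move: i; apply: (@sroot_free _ _ S); apply/rowP => l; rewrite mxE summxE.
  have := congr1 (fun m : 'rV_n => m 0 l) vA; rewrite !mxE.
  under eq_bigr do rewrite vq !mxE -mulrA -intrM.
  rewrite -mulr_sumr -rmorph_sum /= => /eqP; rewrite mulf_eq0 (negPf d0') /=.
  rewrite intr_eq0 => /eqP e0; rewrite -[RHS]e0.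
  rewrite (reindex (@enum_val I predT)) /=; last first.
    by exists enum_rank => y _; rewrite ?enum_valK ?enum_rankK.
  by apply: eq_bigr => k _; rewrite !mxE enum_valK.
have freeR : row_free (map_mx (intr : int -> R) A).
  have -> : map_mx (intr : int -> R) A = map_mx ratr (map_mx (intr : int -> rat) A).
    by rewrite -map_mx_comp; apply/matrixP => k l; rewrite !mxE /= ratr_int.
  by rewrite /row_free mxrank_map.
have [B AB] := row_freeP freeR.
exists (B *m \col_k val (enum_val k)) => i.
have -> : aroot R S i = row (enum_rank i) (map_mx intr A).
  by apply/rowP => l; rewrite !mxE enum_rankK.
by rewrite /pairing mulmxA -row_mul AB -row_mul mul1mx !mxE enum_rankK.
Qed.

Lemma aroot_inj i j : aroot R S i = aroot R S j -> i = j.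
Proof.
move=> e; have [z zP] := aroot_surj (fun j0 => (j0 == i)%:R).
have := zP j; rewrite -e zP eqxx; case: eqP => // _ /eqP.
by rewrite oner_eq0.
Qed.

Lemma aroot_neqN i j : aroot R S i <> - aroot R S j.
Proof.
move=> e; have [z zP] := aroot_surj (fun=> 1).
have := zP i; rewrite e pairingNl zP; lra.
Qed.

Lemma all_roots_aroot i : all_roots S (aroot R S i).
Proof. by exists (sroot S i) => //; exact: km_roots_sroot. Qed.

Lemma all_roots_Naroot i : all_roots S (- aroot R S i).
Proof.
exists (- sroot S i); first exact: km_roots_Nsroot.
by rewrite /intmx map_mxN.
Qed.

Lemma all_roots_center a v : all_roots S a -> (forall i, al i v = 0) -> pairing a v = 0.
Proof.
move=> [b [[c ->] _ _] <-] v0; rewrite /intmx map_mx_sum.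
under eq_bigr do rewrite map_mxZ.
by rewrite pairing_suml big1 // => i _; rewrite v0 mulr0.
Qed.

Lemma continuous_pairing a : continuous (pairing a : AA -> R).
Proof.
rewrite (_ : pairing a = fun y => \sum_j a 0 j * y j 0); last first.
  by apply/funext => y; rewrite pairingE.
apply: (@continuous_big R _ +%R 0 xpredT); first exact: add_continuous.
move=> j _ x; apply: (@cvgM _ _ (nbhs x) _ (fun=> a 0 j) (fun y : AA => y j 0) (a 0 j) (x
  j 0)).
  exact: cvg_cst.
exact: coord_continuous.
Qed.

Lemma nbhs_pairing a u (A : set R) : open A -> A (pairing a u) ->
  nbhs u [set v | A (pairing a v)].
Proof.
move=> oA Au; apply: (continuous_pairing (a := a) (x := u)).
exact: open_nbhs_nbhs.
Qed.

Lemma nbhs_line x u (N : set AA) : nbhs x N ->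
  exists2 e : R, 0 < e & forall t, `|t| < e -> N (x + t *: u).
Proof.
move=> xN; have /(_ N) : ((fun t : R => x + t *: u) @ (0:R)) --> x.
  rewrite -[X in _ --> X]addr0 -(scale0r u).
  by apply: cvgD; [exact: cvg_cst|apply: cvgZr_tmp; exact: cvg_id].
move=> /(_ xN) /nbhs_ballP [e e0 eN]; exists e => // t te; apply: eN.
by rewrite /ball /= sub0r normrN.
Qed.

Lemma closure_line (V : set AA) u v : (forall t, 0 < t -> V (u + t *: v)) -> closure V u.
Proof.
move=> uV N /(nbhs_line v) [e e0 eN]; exists (u + (e / 2) *: v); split.
  by apply: uV; rewrite divr_gt0.
by apply: eN; rewrite ger0_norm; lra.
Qed.

Lemma closure_pairing_ge0 (V : set AA) a u : (forall v, V v -> 0 <= pairing a v) ->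
  closure V u -> 0 <= pairing a u.
Proof.
move=> Va cu; rewrite leNgt; apply/negP => u0.
have /cu [v [/Va v0]] /= : nbhs u [set v | pairing a v < 0].
  by apply: (nbhs_pairing (A := [set y | y < 0])) => //; exact: open_lt.
by rewrite ltNge v0.
Qed.


Lemma dominantD u v : dominant S u -> dominant S v -> dominant S (u + v).
Proof. by move=> ud vd i; rewrite pairingD addr_ge0. Qed.

Lemma dominantZ t u : 0 <= t -> dominant S u -> dominant S (t *: u).
Proof. by move=> t0 ud i; rewrite pairingZ mulr_ge0. Qed.

Lemma closure_chamberE : closure (std_chamber S) = (dominant S : set AA).
Proof.
apply/seteqP; split=> u.
  by move=> cu i; apply: closure_pairing_ge0 cu => v /(_ i) /ltW.
have [z z1] := aroot_surj (fun=> 1) => ud.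
apply: (closure_line (v := z)) => t t0 i.
by rewrite pairingD pairingZ z1 mulr1 ltr_wpDl.
Qed.

Lemma tits_dominant u : dominant S u -> tits_cone S u.
Proof.
move=> ud; exists 1%:M, u; split; [exact: weyl1| |by rewrite mul1mx].
by rewrite closure_chamberE.
Qed.

Lemma spherical_chamber : spherical S (std_chamber S : set AA).
Proof.
have [z z1] := aroot_surj (fun=> 1); exists z; first by move=> i; rewrite z1.
left; apply: (filterS (P := [set v | forall i, 0 < al i v])).
  by move=> v v0; apply: tits_dominant => i; exact: ltW.
apply: (@filter_forall _ I (fun i => [set v : AA | 0 < al i v]) (nbhs z)) => i.
apply: (nbhs_pairing (A := [set y | 0 < y])).
  exact: open_gt.
by rewrite /= z1.
Qed.

(** Near a point of the panel, [al j] and its composite with [r i] stay positive for all j different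
    from i. There [v] or [r i *m v] is dominant, according to the sign of [al i v]. *)
Lemma spherical_panel i : spherical S (std_vface S [set i] : set AA).
Proof.
have [z z1] := aroot_surj (fun j => (j != i)%:R); exists z.
  by split=> j; rewrite inE z1; case: eqP.
left; apply: (filterS (P := [set v | forall j, j != i -> 0 < al j v] `&`
    [set v | forall j, j != i -> 0 < pairing (aroot R S j *m refl_mx R S i) v])).
  move=> v [v0 v1]; have [iv|iv] := lerP 0 (al i v).
    apply: tits_dominant => j; have [->//|ji] := eqVneq j i.
    by apply/ltW/v0.
  exists (refl_mx R S i), (refl_mx R S i *m v); split.
  - exact: weyl_refl.
  - rewrite closure_chamberE => j; have [->//|ji] := eqVneq j i.
      by rewrite aroot_refl_diag oppr_ge0 ltW.
    by have := v1 _ ji; rewrite /pairing mulmxA => /ltW.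
  - by rewrite reflK.
have near_pos (a : I -> 'rV[R]_n) : (forall j, j != i -> 0 < pairing (a j) z) ->
    nbhs z [set v | forall j, j != i -> 0 < pairing (a j) v].
  move=> az; apply: (@filter_forall _ I (fun j => [set v : AA | j != i ->
    0 < pairing (a j) v]) (nbhs z)) => j.
  have [->|ji] := eqVneq j i; first by apply: filterS filterT.
  have h : nbhs z [set v : AA | 0 < pairing (a j) v].
    by apply: (nbhs_pairing (A := [set y | 0 < y])); [exact: open_gt|exact: az].
  by apply: filterS h => v v0 _.
apply: filterI; apply: near_pos => j ji; first by rewrite z1 ji.
rewrite /pairing -mulmxA -/(pairing _ _) aroot_refl !z1 ji eqxx mul0r subr0.
exact: ltr01.
Qed.

Definition enclosed (k : 'rV[R]_n -> option int) : set AA :=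
  \bigcap_(a in all_roots S) half a (k a).

(** Recession directions of a half-space do not depend on the base point. *)
Lemma half_ray a m z q v t : half a m z -> (forall t', 0 <= t' ->
  half a m (q + t' *: v)) ->
  0 <= t -> half a m (z + t *: v).
Proof.
case: m => //= m z0 qv t0; suff v0 : 0 <= pairing a v.
  by rewrite pairingD pairingZ addrAC addr_ge0 // mulr_ge0.
rewrite leNgt; apply/negP => v0.
set b := pairing a q + m%:~R.
have b0 : 0 <= b by have := qv 0 (lexx _); rewrite scale0r addr0.
(* At this parameter the affine form would take the value -1. *)
have t0' : 0 <= (b + 1) / - pairing a v.
  by rewrite divr_ge0 // ?oppr_ge0 ?(ltW v0) // addr_ge0.
have := qv _ t0'; rewrite pairingD pairingZ invrN mulrN mulNr mulfVK ?lt_eqF //.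
by rewrite addrAC -/b; lra.
Qed.

Lemma enclosed_ray k z q v t : enclosed k z -> (forall t', 0 <= t' ->
  enclosed k (q + t' *: v)) ->
  0 <= t -> enclosed k (z + t *: v).
Proof.
move=> kz kq t0 a ra; apply: half_ray t0 => [|t' t'0]; first exact: kz.
exact: kq.
Qed.

Lemma enclosed_closed k z v e : 0 < e ->
  (forall t, 0 < t < e -> enclosed k (z + t *: v)) -> enclosed k z.
Proof.
move=> e0 kz a ra; have {}kz t (te : 0 < t < e) := kz t te a ra.
case: (k a) kz => //= m kz; rewrite leNgt; apply/negP => z0.
set b := pairing a z + m%:~R in z0; set c := pairing a v.
have c0 : 0 < c.
  have := kz (e / 2); rewrite pairingD pairingZ addrAC -/b -/c => /(_ _) h.
  have {}h : 0 <= b + e / 2 * c by apply: h; apply/andP; split; lra.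
  rewrite ltNge; apply/negP => c0; nra.
(* For such [t] the form is still at most [b / 2], hence negative. *)
pose t := Num.min (e / 2) (- b / c / 2).
have t0 : 0 < t.
  by rewrite lt_min !divr_gt0 // oppr_gt0.
have te : t < e by rewrite gt_min; apply/orP; left; lra.
have := kz t; rewrite t0 te => /(_ isT); rewrite pairingD pairingZ addrAC -/b -/c.
have tb : t <= - b / c / 2 by rewrite ge_min lexx orbT.
have : t * c <= - b / 2.
  have -> : - b / 2 = (- b / c / 2) * c by field; rewrite gt_eqF.
  by rewrite ler_pM2r.
lra.
Qed.

Lemma enclosed_center k z v : (forall i, al i v = 0) -> enclosed k z ->
  enclosed k (z + v).
Proof.
move=> v0 kz a ra; have := kz a ra; case: (k a) => //= m.
by rewrite pairingD (all_roots_center ra v0) addr0.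
Qed.

Lemma face_enclosed k x V : enclosed k x -> (forall v, V v -> forall i, al i v = 0) ->
  face S x V (enclosed k).
Proof.
move=> kx V0; exists k, (fun=> None), setT; split; first exact: filterT.
  move=> _ [_ [v Vv <-]] a ra; split=> //.
  exact: (enclosed_center (V0 v Vv) kx).
by move=> z zk a ra; have [] := zk a ra.
Qed.

Lemma face_line x V E v : face S x V E -> (forall t, 0 < t -> V (t *: v)) ->
  exists2 e : R, 0 < e & forall t, 0 < t < e -> E (x + t *: v).
Proof.
move=> [k [k' [N [Nx NV kE]]]] Vv; have [e e0 eN] := nbhs_line v Nx.
exists e => // t /andP[t0 te]; apply: kE; apply: NV; split.
  by apply: eN; rewrite gtr0_norm.
by exists (t *: v) => //; exact: Vv.
Qed.

Lemma face_center x V E : face S x V E -> V 0 -> E x.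
Proof.
move=> [k [k' [N [Nx NV kE]]]] V0; apply: kE; apply: NV; split.
  exact: nbhs_singleton.
by exists 0 => //; rewrite addr0.
Qed.

Lemma vface_std J : vface S false (std_vface S J : set AA).
Proof.
exists 1%:M, J; split; first exact: weyl1.
apply/seteqP; split=> [v Jv|_ [v Jv <-]]; rewrite /sgnr expr0.
  by exists v => //; rewrite mul1mx scale1r.
by rewrite mul1mx scale1r.
Qed.

Lemma vface_stdN J : vface S true [set - v | v in (std_vface S J : set AA)].
Proof.
exists 1%:M, J; split; first exact: weyl1.
by apply/seteqP; split=> _ [v Jv <-]; exists v => //; rewrite /sgnr expr1 mul1mx scaleN1r.
Qed.

Lemma std_chamberE : (std_chamber S : set AA) = std_vface S finset.set0.
Proof.
apply/seteqP; split=> v; first by move=> v0; split=> i; rewrite inE.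
by move=> [_ v0] i; apply: v0; rewrite inE.
Qed.

End Geometry.

(** * Charts of a masure and sector germs *)

Ltac vec_ring := apply/matrixP => ? ?; rewrite !mxE; ring.

Section Extra.
Context (R : realType) (I : finType) (n : nat) (S : root_datum I n).
Local Notation AA := 'cV[R]_n.
Local Notation al i x := (pairing (aroot R S i) x).
Implicit Types (u v x y z : AA) (w : 'M[R]_n).

Lemma nat_above (val : I -> R) : exists m : nat, forall i, val i < m%:R.
Proof.
exists (\sum_i Num.bound `|val i|) => i.
apply: le_lt_trans (ler_norm _) _; apply: lt_le_trans (archi_boundP (normr_ge0 _)) _.
by rewrite ler_nat (bigD1 i) //= leq_addr.
Qed.

Lemma dominant_above x : exists2 y, dominant S y & dominant S (y - x).
Proof.
have [m mP] := nat_above (fun i => al i x).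
have [y yP] := aroot_surj S (fun=> m%:R : R); exists y => i.
  by rewrite yP.
by rewrite pairingB yP subr_ge0 ltW.
Qed.

Lemma chamberD u v : dominant S u -> std_chamber S v -> std_chamber S (u + v).
Proof. by move=> ud vc i; rewrite pairingD ltr_wpDl. Qed.

Lemma chamber_dominant u : std_chamber S u -> dominant S u.
Proof. by move=> uc i; exact: ltW. Qed.

Lemma chamber_nonempty : exists u : AA, std_chamber S u.
Proof. by have [z z1] := aroot_surj S (fun=> 1 : R); exists z => i; rewrite z1. Qed.

(** Uniqueness of the dominant vector in an orbit makes [w] fix the chamber pointwise, and every
    vector is a difference of two vectors of the chamber. *)
Lemma weyl_fix_chamber w : weyl S w ->
  (forall u, std_chamber S u -> dominant S (w *m u)) -> forall v, w *m v = v.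
Proof.
move=> ww wd v; have [z zc] := chamber_nonempty.
have [y yd yvd] := dominant_above (- v).
have fix_ch u : std_chamber S u -> w *m u = u.
  by move=> uc; apply: (dominant_orbit_eq (chamber_dominant uc)) => //; exact: wd.
have e1 : w *m (y + z) = y + z by apply/fix_ch/chamberD.
have e2 : w *m (v + (y + z)) = v + (y + z).
  by apply/fix_ch; rewrite addrA; apply/chamberD => //; rewrite -(opprK v) addrC.
by move: e2; rewrite mulmxDr e1 => /addIr.
Qed.

Lemma face_up x V (E E' : set AA) : face S x V E -> E `<=` E' -> face S x V E'.
Proof.
move=> [k [k' [N [Nx NV kE]]]] EE; exists k, k', N; split=> //.
exact: subset_trans kE EE.
Qed.

Definition simple_bounds (m : int) (a : 'rV[R]_n) : option int :=
  if `[< exists i, a = aroot R S i >] then Some (- m) else None.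

Lemma enclosed_simple_bounds m z :
  enclosed S (simple_bounds m) z <-> forall i, m%:~R <= al i z.
Proof.
split=> [h i|h a _].
  have := h _ (all_roots_aroot R S i); rewrite /simple_bounds.
  case: asboolP => [_|[]]; last by exists i.
  by rewrite /= rmorphN /=; lra.
rewrite /simple_bounds; case: asboolP => [[i ->]|_] //=.
by rewrite rmorphN /=; have := h i; lra.
Qed.

Lemma chimney_germP x V P (E : set AA) : chimney_germ S (face S x V) P E <->
  exists u k F0, [/\ closure P u, face S x V F0,
    forall y v, F0 y -> P v -> enclosed S k (y + u + v) & enclosed S k `<=` E].
Proof.
split.
  move=> [u cu [k [[E0 [F0 F0f F0E0] E0k] kE]]]; exists u, k, F0; split=> //.
  move=> y v F0y Pv; apply: E0k; exists (y + u); last by exists v.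
  by apply: F0E0; exists y => //; exists u.
move=> [u [k [F0 [cu F0f F0k kE]]]]; exists u => //; exists k; split=> //.
exists [set y + u | y in F0].
  by exists F0 => // _ [y F0y [_ -> <-]]; exists y.
by move=> _ [_ [y F0y <-] [v Pv <-]]; exact: F0k.
Qed.

End Extra.

Section MasureBasics.
Context (R : realType) (I : finType) (n : nat) (S : root_datum I n).
Context (M : apartment_system R n) (masureM : is_masure S M).
Local Notation AA := 'cV[R]_n.
Local Notation al i x := (pairing (aroot R S i) x).
Local Notation splayed := (in_masure (@is_splayed_chimney_germ R I n S)).
Implicit Types (A B : set M) (f g : AA -> M) (x y : M) (p q u v z c : AA)
  (w : 'M[R]_n) (phi : M -> M) (F Rg : set_system M).

Definition chart A f := is_apt A /\ apt_isom A f.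

Lemma weyl_unit w : weyl S w -> forall z, exists z', w *m z' = z.
Proof.
move=> /weyl_inv[w' _ [_ e]] z.
by exists (w' *m z); rewrite mulmxA e mul1mx.
Qed.

Lemma weyl_inj w : weyl S w -> injective (fun z : AA => w *m z).
Proof.
move=> /weyl_inv[w' _ [e _]] z z' /(congr1 (mulmx w')).
by rewrite !mulmxA e !mul1mx.
Qed.

Lemma chart_inj A f : chart A f -> injective f.
Proof.
move=> [aA]; have [f0 [f0i _ ->]] := masure_MA1 masureM aA.
move=> [_ [w [q [ww _ ->]]] <-] z z' /f0i /addIr; exact: weyl_inj.
Qed.

Lemma chart_range A f : chart A f -> range f = A.
Proof.
move=> [aA]; have [f0 [f0i <- ->]] := masure_MA1 masureM aA.
move=> [_ [w [q [ww _ ->]]] <-]; apply/seteqP; split=> [_ [z _ <-]|_ [z _ <-]].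
  by exists (affmap w q z).
have [z' e] := weyl_unit ww (z - q); exists z' => //.
by rewrite /= /affmap e subrK.
Qed.

Lemma chart_in A f z : chart A f -> A (f z).
Proof. by move=> /chart_range <-; exists z. Qed.

Lemma chart_pt A f x : chart A f -> A x -> exists p, f p = x.
Proof. by move=> /chart_range <- [p _ <-]; exists p. Qed.

Lemma apt_chart A : is_apt A -> exists f, chart A f.
Proof.
move=> aA; have [f0 [_ _ e]] := masure_MA1 masureM aA.
exists (f0 \o affmap 1%:M 0); split=> //; rewrite e.
exists (affmap 1%:M 0) => //; exists 1%:M, 0; split=> //; first exact: weyl1.
by exists (fun=> 0); rewrite big1 // => i _; rewrite scale0r.
Qed.

Lemma chart_trans A f g : chart A f -> chart A g ->
  exists w c, weyl S w /\ forall z, g z = f (w *m z + c).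
Proof.
move=> [aA]; have [f0 [f0i _ e]] := masure_MA1 masureM aA.
rewrite /chart e => -[_ [w [q [ww _ ->]]] <-] [_ [_ [w1 [q1 [ww1 _ ->]]] <-]].
have [w' ww' [_ ew]] := weyl_inv ww.
exists (w' *m w1), (w' *m (q1 - q)); split; first exact: weyl_mul.
move=> z; rewrite /= /affmap; congr f0.
by rewrite -mulmxA -mulmxDr mulmxA ew mul1mx addrA subrK.
Qed.

Lemma chart_weyl A f w : chart A f -> weyl S w -> chart A (fun z => f (w *m z)).
Proof.
move=> [aA]; have [f0 [f0i _ e]] := masure_MA1 masureM aA.
rewrite /chart e => -[_ [w1 [q [ww qq ->]]] <-] ww1; split=> //.
exists (affmap (w1 *m w) q).
  by exists (w1 *m w), q; split=> //; exact: weyl_mul.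
by apply/funext => z; rewrite /= /affmap mulmxA.
Qed.

Lemma weyl_iso_trans A B phi f g : weyl_iso S A B phi -> chart A f -> chart B g ->
  exists w c, weyl S w /\ forall z, phi (f z) = g (w *m z + c).
Proof.
move=> iso [_ cf] [_ cg]; have [_ [w [q [ww _ ->]]] e] := iso _ _ cf cg.
by exists w, q.
Qed.

Lemma weyl_iso_chart A B phi f : weyl_iso S A B phi -> chart A f -> is_apt B ->
  chart B (phi \o f).
Proof.
move=> iso [_ cf] aB; split=> //; have [f0 [_ _ e]] := masure_MA1 masureM aB.
have cf0 : apt_isom B (f0 \o affmap 1%:M 0).
  rewrite e; exists (affmap 1%:M 0) => //; exists 1%:M, 0; split=> //; first exact: weyl1.
  by exists (fun=> 0); rewrite big1 // => i _; rewrite scale0r.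
have [w ww ew] := iso _ _ cf cf0; rewrite e; exists w => //.
by apply/funext => z; rewrite /= ew /= /affmap mul1mx addr0.
Qed.

Lemma cl_aptP A F E : is_apt A -> cl_apt S A F E ->
  exists f k, [/\ chart A f, F (f @` enclosed S k) & f @` enclosed S k `<=` E].
Proof.
move=> aA [f cf [k [Fk kE]]]; exists f, k; split=> //.
by move=> _ [z kz <-]; exact: kE.
Qed.

(** Recession again: the enclosure contains [g p] and rays of direction [v], hence the ray from
    [g p]. The chart hidden in [cl_apt] need not be [g], so the enclosed set is moved by the
    transition map. *)
Lemma cl_apt_ray A F E g p v t : cl_apt S A F E -> chart A g ->
  (forall Z, F Z -> Z (g p)) ->
  (forall Z, F Z -> exists q, forall t', 0 <= t' -> Z (g (q + t' *: v))) ->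
  0 <= t -> E (g (p + t *: v)).
Proof.
move=> clE cg Fp Fv t0; have [f [k [cf Fk kE]]] := cl_aptP cg.1 clE.
have [w [c [ww e]]] := chart_trans cf cg.
have inv z : (f @` enclosed S k) (g z) -> enclosed S k (w *m z + c).
  by rewrite e => -[z' kz' /(chart_inj cf) <-].
have pk := inv _ (Fp _ Fk); have [q qk] := Fv _ Fk.
apply: kE; rewrite e; exists (w *m (p + t *: v) + c) => //.
rewrite mulmxDr addrAC -scalemxAr; apply: (enclosed_ray pk (q :=
  w *m q + c)) => // t' t'0.
by have := inv _ (qk t' t'0); rewrite mulmxDr addrAC -scalemxAr.
Qed.

(** The origin [t = 0], absent from the hypothesis, is gained because enclosed sets are closed. *)
Lemma cl_apt_segment A F E g p v : cl_apt S A F E -> chart A g ->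
  (forall Z, F Z -> exists2 e : R, 0 < e & forall t, 0 < t < e -> Z (g (p + t *: v))) ->
  exists2 e : R, 0 < e & forall t, 0 <= t < e -> E (g (p + t *: v)).
Proof.
move=> clE cg Fv; have [f [k [cf Fk kE]]] := cl_aptP cg.1 clE.
have [w [c [ww e]]] := chart_trans cf cg.
have inv z : (f @` enclosed S k) (g z) -> enclosed S k (w *m z + c).
  by rewrite e => -[z' kz' /(chart_inj cf) <-].
have [d d0 dk] := Fv _ Fk; exists d => // t /andP[t0 td].
have {}dk t' (h : 0 < t' < d) : enclosed S k (w *m p + c + t' *: (w *m v)).
  by have := inv _ (dk t' h); rewrite mulmxDr addrAC -scalemxAr.
apply: kE; rewrite e; exists (w *m (p + t *: v) + c) => //.
rewrite mulmxDr addrAC -scalemxAr; move: t0; rewrite le_eqVlt => /orP[/eqP<-|t0].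
  rewrite scale0r addr0; exact: (enclosed_closed d0 dk).
by apply: dk; rewrite t0 td.
Qed.

(** (MA3) and (MA4) speak of faces. A point is replaced by the face at it along the smallest
    vectorial face, and (MA2) for the point shows that both apartments contain this face. *)
Lemma point_face A B x : is_apt A -> is_apt B -> A x -> B x ->
  exists F, [/\ in_masure (@is_face R I n S) F, contains A F, contains B F &
    forall E, F E -> E x].
Proof.
move=> aA aB Ax Bx; have [f cf] := apt_chart aA.
have [p fp] := chart_pt cf Ax.
have sit : ma2_situation S A B (fmap f (globally [set p])).
  split=> //.
    exists f, (globally [set p]); split=> //; first exact: cf.2.
    by constructor 1; exists p.
  by exists [set x] => [_ ->|_ ->].
have [[E clE EAB] _] := masure_MA2 masureM sit.
have [f1 [k [cf1 Fk kE]]] := cl_aptP aA clE.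
have [p1 kp1 f1p1] := Fk p erefl.
pose V0 : set AA := std_vface S [set: I].
have V00 : V0 0 by split=> i; rewrite ?inE // pairing0.
have kf : face S p1 V0 (enclosed S k).
  apply: face_enclosed => // v [v0 _] i; apply: v0; by rewrite inE.
exists (fmap f1 (face S p1 V0)); split.
- exists A => //; exists f1, (face S p1 V0); split=> //; first exact: cf1.2.
  by exists p1, false, V0; split=> //; exact: vface_std.
- exists (f1 @` enclosed S k); first by apply: (face_up kf) => z kz; exists z.
  by move=> y /kE /EAB[].
- exists (f1 @` enclosed S k); first by apply: (face_up kf) => z kz; exists z.
  by move=> y /kE /EAB[].
- by move=> Z /face_center /(_ V00); rewrite /= f1p1 fp.
Qed.

Lemma MA3_point Rg x : splayed Rg -> exists A, [/\ is_apt A, contains A Rg & A x].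
Proof.
move=> sR; have [B aB Bx] := masure_cover masureM x.
have [F [fF _ _ Fx]] := point_face aB aB Bx Bx.
have [|A [aA AR [E FE EA]]] := masure_MA3 masureM (Rg := Rg) (F := F).
  by split=> //; left.
by exists A; split=> //; apply: EA; exact: Fx.
Qed.

(** The last clause is what the enclosure in (MA4) adds: the rays from [x] towards the germ are
    fixed too. *)
Lemma MA4_point Rg A B x : splayed Rg -> is_apt A -> is_apt B ->
  contains A Rg -> contains B Rg -> A x -> B x ->
  exists phi, [/\ weyl_iso S A B phi, phi x = x,
    exists2 Z, Rg Z & forall y, Z y -> phi y = y &
    forall g p v, chart A g -> g p = x ->
      (forall Z, Rg Z -> exists q, forall t, 0 <= t -> Z (g (q + t *: v))) ->
      forall t, 0 <= t -> phi (g (p + t *: v)) = g (p + t *: v)].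
Proof.
move=> sR aA aB AR BR Ax Bx.
have [F [fF AF BF Fx]] := point_face aA aB Ax Bx.
have sit : ma4_situation S A B Rg F by split=> //; split=> //; left.
have [phi iso [E clE Efix]] := masure_MA4 masureM sit.
have [f1 [k [cf1 [Z RZ [Z' FZ' eZ]] kE]]] := cl_aptP aA clE.
have ZE : Z `|` Z' `<=` E by rewrite eZ.
exists phi; split=> //.
- by apply: Efix; apply: ZE; right; apply: Fx.
- by exists Z => // y Zy; apply: Efix; apply: ZE; left.
- move=> g p v cg gp Rv t t0; apply: Efix; apply: (cl_apt_ray clE) => //.
    by move=> _ [Y RY [Y' FY' <-]]; right; rewrite gp; exact: Fx.
  move=> _ [Y RY [Y' FY' <-]]; have [q qY] := Rv _ RY.
  by exists q => t' t'0; left; exact: qY.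
Qed.

Lemma chimney_germ_splayed A f p s V P : chart A f -> vface S s V ->
  vface S false P -> spherical S P ->
  splayed (fmap f (chimney_germ S (face S p V) P)).
Proof.
move=> [aA cf] Vs Pf Ps; exists A => //; exists f, (chimney_germ S (face S p V) P).
split=> //; exists (face S p V), false, P; split=> //.
by exists p, s, V.
Qed.

(** Positive sector germs are indexed by charts; replacing [f] by [f] composed with [w] in W^v runs
    through those of one apartment. *)
Definition sgerm f : set_system M := fmap f (sface_germ 0 (std_chamber S)).

Lemma sface_germP (E : set AA) : sface_germ 0 (std_chamber S) E <->
  exists2 u, dominant S u & forall c, std_chamber S c -> E (u + c).
Proof.
split=> [[u]|[u ud uE]].
  rewrite closure_chamberE => ud uE; exists u => // c cc.
  by apply: uE; exists c => //; rewrite add0r.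
exists u; first by rewrite closure_chamberE.
by move=> _ [c cc <-]; rewrite add0r; exact: uE.
Qed.

Lemma sgermP f Z : sgerm f Z <->
  exists2 u, dominant S u & forall c, std_chamber S c -> Z (f (u + c)).
Proof. exact: sface_germP. Qed.

(** Exhibits a sector germ as the germ of a chimney, the form in which (MA3) and (MA4) accept it. *)
Lemma sgermE f : sgerm f =
  fmap f (chimney_germ S (face S 0 (std_vface S [set: I])) (std_chamber S)).
Proof.
set V0 := std_vface S [set: I].
have V00 : V0 0 by split=> i; rewrite ?inE // pairing0.
have Vc (v : AA) : V0 v -> forall i, al i v = 0 by move=> [v0 _] i; apply: v0;
  rewrite inE.
congr fmap; apply/seteqP; split=> E.
  move=> /sface_germP[u ud uE]; apply/chimney_germP.
  (* Rounding [u] up to an integer level [m] turns a subsector of [u + C] into an enclosed set. *)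
  have [m mP] := nat_above (fun i => al i u).
  have [y yP] := aroot_surj S (fun=> m%:R : R).
  exists y, (simple_bounds S m), (enclosed S (simple_bounds S 0)); split.
  - by rewrite closure_chamberE => i; rewrite yP.
  - by apply: face_enclosed => //; apply/enclosed_simple_bounds => i; rewrite pairing0.
  - move=> z v /enclosed_simple_bounds z0 vc; apply/enclosed_simple_bounds => i.
    by rewrite !pairingD yP; have := vc i; have := z0 i; rewrite /intr /=; lra.
  - move=> z /enclosed_simple_bounds zm; rewrite -(subrK u z) addrC; apply: uE => i.
    by rewrite pairingB subr_gt0; apply: lt_le_trans (mP i) (zm i).
move=> /chimney_germP[u [k [F0 [cu F0f F0k kE]]]]; apply/sface_germP.
rewrite closure_chamberE in cu; exists u => // c cc.
by apply: kE; rewrite -(add0r u); apply: F0k => //; exact: face_center F0f V00.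
Qed.

Lemma sgerm_splayed A f : chart A f -> splayed (sgerm f).
Proof.
move=> cf; rewrite sgermE; apply: (chimney_germ_splayed _ cf).
- exact: vface_std.
- rewrite std_chamberE; exact: vface_std.
- exact: spherical_chamber.
Qed.

Lemma sgerm_contains A f : chart A f -> contains A (sgerm f).
Proof.
move=> cf; exists A => //; apply/sgermP; exists 0.
  by move=> i; rewrite pairing0.
by move=> c _; exact: chart_in cf.
Qed.

Lemma sgerm_ray f v : dominant S v -> forall Z, sgerm f Z ->
  exists q, forall t, 0 <= t -> Z (f (q + t *: v)).
Proof.
move=> vd Z /sgermP[u ud uZ]; have [z zc] := chamber_nonempty R S.
exists (u + z) => t t0; rewrite -addrA; apply: uZ.
by rewrite addrC; apply: chamberD => //; exact: dominantZ.
Qed.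

Lemma sgerm_agree f g u : (forall z, dominant S (z - u) -> g z = f z) ->
  sgerm g = sgerm f.
Proof.
have half_agree (f1 g1 : AA -> M) : (forall z, dominant S (z - u) -> g1 z = f1 z) ->
    sgerm f1 `<=` sgerm g1.
  move=> fg Z /sgermP[v vd vZ]; have [y yd yud] := dominant_above S u.
  apply/sgermP; exists (y + v); first exact: dominantD.
  move=> c cc; rewrite fg.
    by rewrite -addrA addrCA; apply: vZ; exact: chamberD.
  rewrite (_ : _ - u = y - u + v + c); last by vec_ring.
  by do 2?apply: dominantD => //; exact: chamber_dominant.
by move=> fg; apply/seteqP; split; apply: half_agree => // z /fg.
Qed.

Lemma sgerm_chart A B f : chart B f -> is_apt A -> contains A (sgerm f) ->
  exists g, [/\ chart A g, sgerm g = sgerm f &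
    exists u, forall z, dominant S (z - u) -> g z = f z].
Proof.
move=> cf aA Af; have [E /sgermP[u ud uE] EA] := Af.
have [z0 z0c] := chamber_nonempty R S.
have [phi [iso _ [Z fZ Zfix] _]] := MA4_point (sgerm_splayed cf) cf.1 aA
  (sgerm_contains cf) Af (chart_in _ cf) (EA _ (uE _ z0c)).
have agree : exists u0, forall z, dominant S (z - u0) -> (phi \o f) z = f z.
  have [u0 _ u0Z] := (sgermP _ _).1 fZ; exists (u0 + z0) => z zd.
  rewrite /= Zfix // -(subrK u0 z) addrC; apply: u0Z.
  by rewrite -(subrK z0 (z - u0)); apply: chamberD => //; rewrite -addrA -opprD.
exists (phi \o f); split=> //; first exact: weyl_iso_chart iso cf aA.
by have [u0 h] := agree; exact: sgerm_agree h.
Qed.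

Lemma sgerm_chart_point B f x : chart B f ->
  exists A g p, [/\ chart A g, sgerm g = sgerm f, g p = x &
    exists u, forall z, dominant S (z - u) -> g z = f z].
Proof.
move=> cf; have [A [aA Af Ax]] := MA3_point x (sgerm_splayed cf).
have [g [cg e gf]] := sgerm_chart cf aA Af; have [p gp] := chart_pt cg Ax.
by exists A, g, p.
Qed.

(** Independence of [x +_s u] from the apartment. The isomorphism of (MA4) fixes the ray from [x],
    and its linear part in the two charts is trivial because it preserves the common sector germ. *)
Lemma sgerm_flow A B f g p q u : chart A f -> chart B g -> sgerm f = sgerm g ->
  f p = g q -> dominant S u -> f (p + u) = g (q + u).
Proof.
move=> cf cg fg fpgq ud.
have Bf : contains B (sgerm f) by rewrite fg; exact: sgerm_contains.
have Bx : B (f p) by rewrite fpgq; exact: chart_in cg.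
have [phi [iso phix [Z fZ Zfix] fixray]] := MA4_point (sgerm_splayed cf) cf.1 cg.1
  (sgerm_contains cf) Bf (chart_in _ cf) Bx.
have [w [c [ww e]]] := weyl_iso_trans iso cf cg.
have [u1 u1d u1Z] := (sgermP _ _).1 fZ.
have : sgerm f (g @` std_chamber S).
  rewrite fg; apply/sgermP; exists 0; first by move=> i; rewrite pairing0.
  by move=> c0 c0c; exists (0 + c0); rewrite ?add0r.
move=> /sgermP[u2 u2d u2C].
have wfix v : w *m v = v.
  apply: (weyl_fix_chamber ww) => y yc i; rewrite leNgt; apply/negP => wy.
  have pos t : 0 < t -> 0 < al i (w *m (u1 + u2 + t *: y) + c).
    move=> t0; have tc : std_chamber S (t *: y) by move=> j; rewrite pairingZ mulr_gt0.
    have h1 : Z (f (u1 + u2 + t *: y)) by rewrite -addrA; apply/u1Z/chamberD.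
    have [z zc] : (g @` std_chamber S) (f (u1 + u2 + t *: y)).
      by rewrite (addrC u1) -addrA; apply/u2C/chamberD.
    by rewrite -(Zfix _ h1) e => /(chart_inj cg) <-; exact: zc.
  pose b := al i (w *m (u1 + u2) + c).
  have pos' t : 0 < t -> 0 < b + t * al i (w *m y).
    by move=> /pos; rewrite mulmxDr addrAC pairingD -scalemxAr pairingZ.
  have t0 : 0 < (`|b| + 1) / - al i (w *m y).
    by rewrite divr_gt0 ?oppr_gt0 // ltr_pwDr.
  have := pos' _ t0; rewrite invrN mulrN mulNr mulfVK ?lt_eqF //.
  have := ler_norm b; lra.
have -> : f (p + u) = phi (f (p + u)).
  by rewrite -(scale1r u) (fixray _ _ _ cf) //; exact: sgerm_ray.
rewrite e wfix addrAC; congr (g (_ + _)); apply: (chart_inj cg).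
by rewrite -(wfix p) -e phix.
Qed.

Lemma sgerm_translate f c : sgerm (fun z => f (z + c)) = sgerm f.
Proof.
apply/seteqP; split=> Z /sgermP[u ud uZ]; apply/sgermP.
  have [y yd ycd] := dominant_above S (u + c).
  exists y => // v vc; have := uZ (y - (u + c) + v).
  have -> : u + (y - (u + c) + v) + c = y + v.
    by vec_ring.
  by apply; exact: chamberD.
have [y yd ycd] := dominant_above S (u - c).
exists y => // v vc; have := uZ (y - (u - c) + v).
have -> : u + (y - (u - c) + v) = y + v + c by vec_ring.
by apply; exact: chamberD.
Qed.

Lemma model_inftyE f : fmap f (model_infty S false) = sgerm f.
Proof.
rewrite /sgerm /model_infty; congr (fmap f (sface_germ _ _)).
by apply/seteqP; split=> [_ [v vc <-]|v vc]; rewrite /sgnr expr0 ?scale1r //;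
  exists v; rewrite ?scale1r.
Qed.

Lemma vweyl_aut_id : vweyl_aut S (id : AA -> AA).
Proof.
have e : id = affmap 1%:M (0 : AA) by apply/funext=> z; rewrite /affmap mul1mx addr0.
split; first by exists 1%:M, 0; split=> //; exact: weyl1.
exists 1%:M, 0; split=> //; first exact: unitmx1.
apply/seteqP; split=> [_ [[V v] Vv <-]|[V v] Vv]; rewrite /= ?image_id ?mul1mx //.
by exists (V, v) => //=; rewrite image_id mul1mx.
Qed.

Lemma splus_chart A f p u : chart A f -> dominant S u ->
  splus S false (sgerm f) (f p) u = f (p + u).
Proof.
move=> cf ud; rewrite /splus; case: xgetP => [y _ /= |].
  move=> [A1 [psi [p1 [aA1 [A1x A1f] [[h [w [ch [[w0 [c0 [ww0 ->]] _] ->]]]]]]]]].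
  rewrite model_inftyE /sgnr expr0 scale1r => ge px ->.
  (* The linear part of the model automorphism is absorbed into the chart; its translation part does
     not change the germ. *)
  pose h' z := h (w0 *m z); have ch' : chart A1 h' by exact: chart_weyl.
  have [c' e'] := weyl_unit ww0 c0.
  have psiE z : (h \o affmap w0 c0) z = h' (z + c').
    by rewrite /= /affmap /h' mulmxDr e'.
  rewrite psiE addrAC; apply/esym; apply: (sgerm_flow cf ch') => //.
    rewrite -ge -(sgerm_translate h' c'); congr sgerm; apply/funext => z.
    by rewrite psiE.
  by rewrite -psiE.
move=> /(_ (f (p + u))) []; exists A, f, p; split=> //.
- exact: cf.1.
- by split; [exact: chart_in cf|exact: sgerm_contains].
- split; last exact: model_inftyE.
  by exists f, id; split=> //; [exact: cf.2|exact: vweyl_aut_id].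
- by rewrite /sgnr expr0 scale1r.
Qed.

Lemma sector_germ_chart s : sector_germ S false s ->
  exists A f, chart A f /\ s = sgerm f.
Proof.
move=> [A aA [f [_ [cf [x [_ [[w ww ->] ->]]]] ->]]].
exists A, (fun z => f (w *m z)); split; first exact: chart_weyl.
have [w' _ [e1 e2]] := weyl_inv ww.
have we (z : AA) : sgnr R false *: (w *m z) = w *m z by rewrite /sgnr expr0 scale1r.
have [z0 z0c] := chamber_nonempty R S.
apply/seteqP; split=> Z.
  move=> [u _ uZ]; have [y yd yud] := dominant_above S (w' *m (x + u)).
  apply/sgermP; exists y => // c cc; apply: uZ.
  exists (w *m (y - w' *m (x + u) + c)).
    by exists (y - w' *m (x + u) + c); [exact: chamberD|rewrite we].
  by rewrite mulmxDr mulmxBr mulmxA e2 mul1mx addrA subrKC -mulmxDr.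
move=> /sgermP[u ud uZ]; have [y yd yud] := dominant_above S (u - w' *m x).
exists (w *m y).
  apply: (closure_line (v := w *m z0)) => t t0.
  exists (y + t *: z0); last by rewrite we mulmxDr scalemxAr.
  by apply: chamberD => // i; rewrite pairingZ mulr_gt0.
move=> _ [_ [c cc <-] <-]; rewrite we.
have := uZ (y - (u - w' *m x) + c) (chamberD yud cc).
rewrite (_ : u + _ = w' *m x + y + c); last by vec_ring.
by rewrite !mulmxDr mulmxA e2 mul1mx.
Qed.

End MasureBasics.

(** * Flows towards adjacent sector germs *)

(** The supremum of the good points is good and cannot be less than [b]. This glues local statements
    whose scale varies from point to point. *)
Lemma real_induction (R : realType) (P : R -> Prop) (a b : R) : a <= b -> P a ->
  (forall t, a <= t < b -> P t ->
    exists2 e, 0 < e & forall t', t < t' < t + e -> P t') ->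
  (forall t, a < t <= b ->
    (forall e, 0 < e -> exists t', [/\ t - e < t' < t, a <= t' & P t']) -> P t) ->
  P b.
Proof.
move=> ab Pa right left; pose E := [set t | a <= t <= b /\ P t].
have Ea : E a by split; rewrite ?lexx.
have supE : has_sup E by split; [exists a|exists b => t [/andP[]]].
set s := sup E; have as_ : a <= s by apply: (ub_le_sup supE.2).
have sb : s <= b by apply: ge_sup => [|t [/andP[]]]; first by exists a.
have Ps : P s.
  have [<-//|sa] := eqVneq a s; apply: contrapT => nPs.
  apply: (nPs); apply: left => [|e e0]; first by rewrite lt_neqAle sa as_.
  have [t [/andP[at_ tb] Pt] st] := sup_adherent e0 supE; exists t; split=> //.
  have ts : t <= s by apply: (ub_le_sup supE.2); split=> //; rewrite at_.
  rewrite st lt_neqAle ts andbT; apply/eqP => e1; apply: nPs; by rewrite -e1.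
move: sb; rewrite le_eqVlt => /orP[/eqP <- //|sb].
have [|e e0 Pe] := right s _ Ps; first by rewrite as_.
pose t := s + Num.min (e / 2) ((b - s) / 2).
have m0 : 0 < Num.min (e / 2) ((b - s) / 2) by rewrite lt_min; apply/andP; split; lra.
have m1 : Num.min (e / 2) ((b - s) / 2) <= e / 2 by rewrite ge_min lexx.
have m2 : Num.min (e / 2) ((b - s) / 2) <= (b - s) / 2 by rewrite ge_min lexx orbT.
have : t <= s.
  apply: (ub_le_sup supE.2); split; first by rewrite /t; apply/andP; split; lra.
  by apply: Pe; rewrite /t; apply/andP; split; lra.
by rewrite /t => h; exfalso; lra.
Qed.

Section PanelFlow.
Context (R : realType) (I : finType) (n : nat) (S : root_datum I n).
Context (M : apartment_system R n) (masureM : is_masure S M).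
Local Notation AA := 'cV[R]_n.
Local Notation al i x := (pairing (aroot R S i) x).
Local Notation splayed := (in_masure (@is_splayed_chimney_germ R I n S)).
Local Notation chart := (@chart R n M).
Context (i : I).
Implicit Types (A B : set M) (f g : AA -> M) (x y : M) (p q u v z c : AA)
  (w : 'M[R]_n) (k : 'rV[R]_n -> option int).

Definition panel : set AA := std_vface S [set i].
Definition center_face : set AA := std_vface S [set: I].

Lemma panelP v : panel v <-> al i v = 0 /\ forall j, j != i -> 0 < al j v.
Proof.
split=> [[v0 v1]|[v0 v1]].
  by split=> [|j ji]; [apply: v0|apply: v1]; rewrite inE.
by split=> j; rewrite inE => ji; [rewrite (eqP ji)|exact: v1].
Qed.

Lemma panelZ t v : 0 < t -> panel v -> panel (t *: v).
Proof.
move=> t0 /panelP[v0 v1]; apply/panelP; rewrite pairingZ v0 mulr0; split=> // j ji.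
by rewrite pairingZ mulr_gt0 // v1.
Qed.

Lemma panel_dominant v : panel v -> dominant S v.
Proof.
move=> /panelP[v0 v1] j; have [->|ji] := eqVneq j i; first by rewrite v0.
exact/ltW/v1.
Qed.

Lemma center_faceP v : center_face v -> forall j, al j v = 0.
Proof. by move=> [v0 _] j; apply: v0; rewrite inE. Qed.

Lemma center_face0 : center_face 0.
Proof. by split=> j; rewrite ?inE // pairing0. Qed.

Lemma closure_panel u : closure panel u -> al i u = 0 /\ forall j, 0 <= al j u.
Proof.
move=> cu; have pos j : 0 <= al j u.
  by apply: closure_pairing_ge0 cu => v /panel_dominant.
split=> //; apply: le_anti; rewrite pos andbT -oppr_ge0.
rewrite -pairingNl.
by apply: closure_pairing_ge0 cu => v /panelP[v0 _]; rewrite pairingNl v0 oppr0.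
Qed.

Lemma closure_panelD u v : closure panel u -> panel v -> panel (u + v).
Proof.
move=> /closure_panel[u0 u1] /panelP[v0 v1]; apply/panelP; rewrite pairingD u0 v0 addr0.
by split=> // j ji; rewrite pairingD ltr_wpDl // v1.
Qed.

Context (v0 : AA) (v0i : al i v0 = 0) (v0j : forall j, j != i -> al j v0 = 1).

Lemma panel_v0 : panel v0.
Proof. by apply/panelP; split=> // j ji; rewrite v0j. Qed.

Lemma closure_panel0 : closure panel 0.
Proof.
by apply: (closure_line (v := v0)) => t t0; rewrite add0r; exact: panelZ panel_v0.
Qed.

Lemma panel_above u : al i u = 0 -> exists2 T : R, 0 <= T & panel (T *: v0 - u).
Proof.
move=> ui; have [m mP] := nat_above (fun j => al j u); exists m%:R => //.
apply/panelP; rewrite pairingB pairingZ ui v0i mulr0 subr0; split=> // j ji.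
by rewrite pairingB pairingZ v0j // mulr1 subr_gt0.
Qed.

Section Base.
Context (B : set M) (f : AA -> M) (cf : chart B f).

(* [g] and [f] agree on an enclosed set [k] stable under the panel cone and
   containing [b]: thus [A] contains the panel germ at infinity based at [b],
   and [g (p + v)] is [x] moved by [v] towards this germ. *)
Definition panel_chart x b A g k p :=
  [/\ chart A g, g p = x, enclosed S k b,
    forall z v, enclosed S k z -> panel v -> enclosed S k (z + v) &
    forall z, enclosed S k z -> g z = f z].

(** The face at [b] is taken along the smallest vectorial face, so that an enclosed set contains it
    as soon as it contains [b]. *)
Definition panel_germ b : set_system M :=
  fmap f (chimney_germ S (face S b center_face) panel).

Lemma panel_germ_splayed b : splayed (panel_germ b).
Proof.
apply: (chimney_germ_splayed _ cf).
- exact: vface_std.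
- exact: vface_std.
- exact: spherical_panel.
Qed.

Lemma panel_chart_contains x b A g k p : panel_chart x b A g k p ->
  contains A (panel_germ b).
Proof.
move=> [cg gp kb kP kf]; exists (f @` enclosed S k); last first.
  by move=> _ [z kz <-]; rewrite -kf //; exact: (chart_in masureM _ cg).
apply/chimney_germP; exists 0, k, (enclosed S k); split=> //.
- exact: closure_panel0.
- by apply: face_enclosed => // v /center_faceP.
- by move=> z v kz Pv; rewrite addr0; exact: kP.
- by move=> z kz; exists z.
Qed.

Lemma panel_germ_cone b Z : panel_germ b Z ->
  exists2 u, closure panel u & forall v, panel v -> Z (f (b + u + v)).
Proof.
move=> /chimney_germP[u [k [F0 [cu F0f F0k kZ]]]]; exists u => // v Pv.
apply: kZ; apply: F0k => //; exact: face_center F0f center_face0.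
Qed.

(** The isomorphism of (MA4) for the panel germ and [x] fixes the ray of direction [v0] from [x].
    Its linear part is known to fix [v0], which is enough along this ray. *)
Lemma panel_chart_flow x b A g k p A' g' k' p' t :
  panel_chart x b A g k p -> panel_chart x b A' g' k' p' -> 0 <= t ->
  g (p + t *: v0) = g' (p' + t *: v0).
Proof.
move=> H H' t0; have [cg gp kb kP kf] := H; have [cg' gp' kb' kP' kf'] := H'.
have Ax : A x by rewrite -gp; exact: (chart_in masureM _ cg).
have Ax' : A' x by rewrite -gp'; exact: (chart_in masureM _ cg').
have [phi [iso phix [Z gZ Zfix] fixray]] := MA4_point masureM (panel_germ_splayed b)
  cg.1 cg'.1 (panel_chart_contains H) (panel_chart_contains H') Ax Ax'.
have [w [c [ww e]]] := weyl_iso_trans iso cg cg'.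
have [u cu uZ] := panel_germ_cone gZ.
have fixed s : 0 < s -> w *m (b + u + s *: v0) + c = b + u + s *: v0.
  move=> s0; have Ps := panelZ s0 panel_v0; have Pus := closure_panelD cu Ps.
  have kz : enclosed S k (b + u + s *: v0) by rewrite -addrA; exact: kP.
  have kz' : enclosed S k' (b + u + s *: v0) by rewrite -addrA; exact: kP'.
  by apply: (chart_inj masureM cg'); rewrite -e (kf _ kz) (kf' _ kz') Zfix //; exact: uZ.
(* Difference of the points fixed at the parameters 1 and 2. *)
have wv0 : w *m v0 = v0.
  have := fixed 1 ltr01; have := fixed 2 (ltr0n _ 2).
  rewrite !scale1r scaler_nat mulr2n !addrA (mulmxDr w _ v0) => h2 h1.
  move: h2; rewrite addrAC h1 => /addrI; exact.
have fixg s : 0 <= s -> phi (g (p + s *: v0)) = g (p + s *: v0).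
  apply: fixray => // Y /panel_germ_cone[u' cu' uY].
  exists (b + u' + v0) => s' s'0.
  have Ps : panel (v0 + s' *: v0).
    by rewrite -{1}(scale1r v0) -scalerDl; apply: panelZ panel_v0; rewrite ltr_pwDl.
  have kz : enclosed S k (b + u' + (v0 + s' *: v0)).
    by rewrite -addrA; apply: kP => //; exact: closure_panelD.
  by rewrite -addrA kf //; exact: uY.
rewrite -fixg // e mulmxDr -scalemxAr wv0 addrAC; congr (g' (_ + _)).
by apply: (chart_inj masureM cg'); rewrite -e gp gp' phix.
Qed.

(** Local constancy comes from thickening the chimney: based on the face at [b] along [V], its germ
    yields one chart that serves all bases [b + t *: c] with small [t], up to a push along the
    panel. *)
Lemma panel_chart_exists x b s V c : vface S s V -> (forall t, 0 < t -> V (t *: c)) ->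
  exists A g k p (T e : R), [/\ 0 <= T, 0 < e &
    forall t, 0 <= t < e -> panel_chart x (b + t *: c + T *: v0) A g k p].
Proof.
move=> Vs Vc; pose thick := fmap f (chimney_germ S (face S b V) panel).
have sR : splayed thick.
  by apply: (chimney_germ_splayed _ cf Vs); [exact: vface_std|exact: spherical_panel].
have [A [aA AR Ax]] := MA3_point masureM x sR.
have [E thE EA] := AR.
(* [MA4_point] asks for a common point of the two apartments; one is taken from the germ. *)
have [y Ay By] : exists2 y, A y & B y.
  move: (thE) => /chimney_germP[u [k [F0 [cu F0f F0k kE]]]].
  have [e e0 eF] := face_line F0f Vc.
  have h : E (f (b + (e / 2) *: c + u + v0)).
    by apply: kE; apply: F0k panel_v0; apply: eF; apply/andP; split; lra.
  by exists (f (b + (e / 2) *: c + u + v0)); [exact: EA|exact: (chart_in masureM _ cf)].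
have BR : contains B thick.
  exists B => //; move: thE => /chimney_germP[u [k [F0 [cu F0f F0k _]]]].
  apply/chimney_germP; exists u, k, F0; split=> // z _.
  exact: (chart_in masureM _ cf).
have [phi [iso _ [Z gZ Zfix] _]] := MA4_point masureM sR cf.1 aA BR AR By Ay.
have cg := weyl_iso_chart masureM iso cf aA.
have [p gp] := chart_pt masureM cg Ax.
move: gZ => /chimney_germP[u [k [F0 [cu F0f F0k kZ]]]].
have [e e0 eF] := face_line F0f Vc.
have [ui uj] := closure_panel cu.
(* Pushing by [T *: v0] goes beyond the unknown shift [u] of the germ. *)
have [T T0 Tu] := panel_above ui.
exists A, (phi \o f), k, p, T, e; split=> // t te; split=> //.
- have pos t' : 0 < t' < e -> enclosed S k (b + t' *: c + T *: v0).
    move=> t'e; rewrite (_ : _ + T *: v0 = b + t' *: c + u + (T *: v0 - u));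
      last by vec_ring.
    by apply: F0k => //; exact: eF.
  move: te => /andP[]; rewrite le_eqVlt => /orP[/eqP<- _|t0 te]; last by apply: pos;
    rewrite t0.
  rewrite scale0r addr0; apply: (enclosed_closed e0 (v := c)) => t' t'e.
  by rewrite addrAC; exact: pos.
- move=> z v kz Pv; rewrite -(scale1r v).
  apply: (enclosed_ray kz (q := b + (e / 2) *: c + u + v)); last exact: ler01.
  move=> t' t'0; rewrite -(addrA _ v) -{1}(scale1r v) -scalerDl; apply: F0k.
    by apply: eF; apply/andP; split; lra.
  by apply: panelZ Pv; rewrite ltr_pwDl.
- by move=> z kz; apply: Zfix; exact: kZ.
Qed.

Lemma panel_chart_shift x b A g k p T : 0 <= T -> panel_chart x b A g k p ->
  panel_chart x (b + T *: v0) A g k p.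
Proof.
rewrite le_eqVlt => /orP[/eqP<-|T0]; first by rewrite scale0r addr0.
by move=> [cg gp kb kP kf]; split=> //; apply: kP => //; exact: panelZ panel_v0.
Qed.

Lemma panel_chart_connected x b c A g k p A' g' k' p' s t :
  std_chamber S c -> 0 <= s -> 0 <= t ->
  panel_chart x b A g k p -> panel_chart x (b + s *: c) A' g' k' p' ->
  g (p + t *: v0) = g' (p' + t *: v0).
Proof.
move=> cc s0 t0 H H'.
(* The value of the flow at the base [b + r *: c]. Two charts may need different pushes [T]; they
   are compared after pushing by both. *)
pose Q r y := exists A g k p T, [/\ 0 <= T, panel_chart x (b + r *: c + T *: v0) A g k p &
  y = g (p + t *: v0)].
have Quniq r y y' : Q r y -> Q r y' -> y = y'.
  move=> [A1 [g1 [k1 [p1 [T1 [T10 H1 ->]]]]]] [A2 [g2 [k2 [p2 [T2 [T20 H2 ->]]]]]].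
  have := panel_chart_shift T20 H1; have := panel_chart_shift T10 H2.
  rewrite -!addrA (addrC (T1 *: v0)) => h2 h1.
  exact: panel_chart_flow h1 h2 t0.
have loc r sg V d : vface S sg V -> (forall t', 0 < t' -> V (t' *: d)) ->
    exists e y, 0 < e /\ forall t', 0 <= t' < e -> forall r',
      r *: c + t' *: d = r' *: c -> Q r' y.
  move=> Vs Vd; have [A1 [g1 [k1 [p1 [T1 [e1 [T10 e10 h]]]]]]] :=
    panel_chart_exists x (b + r *: c) Vs Vd.
  exists e1, (g1 (p1 + t *: v0)); split=> // t' t'e r' er.
  by exists A1, g1, k1, p1, T1; split=> //; rewrite -er addrA; exact: h.
have cc' t' : 0 < t' -> std_vface S finset.set0 (t' *: c).
  by move=> t'0; rewrite -std_chamberE => j; rewrite pairingZ mulr_gt0.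
have locR r := loc r false _ c (vface_std R S finset.set0) cc'.
(* To the left, the thick face is taken along the opposite chamber, which contains [- c]. *)
have locL r : exists e y, 0 < e /\ forall r', r - e < r' <= r -> Q r' y.
  have [t' t'0|e [y [e0 ey]]] := loc r true _ (- c) (vface_stdN R S finset.set0).
    by exists (t' *: c); [exact: cc'|rewrite scalerN].
  exists e, y; split=> // r' /andP[r1 r2]; apply: (ey (r - r')).
    by apply/andP; split; lra.
  by rewrite scalerN -scalerBl; congr (_ *: _); ring.
suff : Q s (g (p + t *: v0)).
  move/Quniq; apply; exists A', g', k', p', 0; split=> //.
  by rewrite scale0r addr0.
apply: (real_induction (P := fun r => Q r (g (p + t *: v0))) s0).
- by exists A, g, k, p, 0; split=> //; rewrite !scale0r !addr0.
- move=> r _ Qr; have [e [y [e0 ey]]] := locR r; exists e => // r' /andP[r1 r2].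
  have Qry : Q r y by apply: (ey 0); rewrite ?lexx ?e0 // scale0r addr0.
  rewrite (Quniq _ _ _ Qr Qry); apply: (ey (r' - r)).
    by apply/andP; split; lra.
  by rewrite -scalerDl; congr (_ *: _); ring.
- move=> r _ near; have [e [y [e0 ey]]] := locL r.
  have [r' [/andP[r1 r2] _ Qr']] := near e e0.
  rewrite (Quniq _ _ _ Qr' (ey r' _)); last by rewrite r1 ltW.
  by apply: ey; rewrite lexx andbT; lra.
Qed.

End Base.

(** Bounds on both [aroot i] and its opposite pin [al i] to one level; on it, lower bounds on the
    other [al j] survive [r i] up to a constant. *)
Definition slab (l m : int) (a : 'rV[R]_n) : option int :=
  if a == aroot R S i then Some (- l)
  else if a == - aroot R S i then Some l
  else if `[< exists j, a = aroot R S j >] then Some (- m) else None.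

Lemma enclosed_slab l m z : enclosed S (slab l m) z <->
  al i z = l%:~R /\ forall j, j != i -> m%:~R <= al j z.
Proof.
split=> [h|[zi zj] a _].
  split.
    have := h _ (all_roots_aroot R S i); rewrite /slab eqxx /= mulrNz.
    have := h _ (all_roots_Naroot R S i); rewrite /slab eqxx.
    by case: eqP => [/esym/aroot_neqN//|_]; rewrite /= pairingNl; lra.
  move=> j ji; have := h _ (all_roots_aroot R S j); rewrite /slab.
  case: eqP => [/aroot_inj/eqP|_]; first by rewrite (negPf ji).
  case: eqP => [/aroot_neqN//|_]; case: asboolP => [_|[]]; last by exists j.
  by rewrite /= mulrNz; lra.
rewrite /slab; case: eqP => [->|ai]; first by rewrite /= zi mulrNz; lra.
case: eqP => [->|_]; first by rewrite /= pairingNl zi; lra.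
case: asboolP => [[j aj]|_] //=; rewrite aj mulrNz.
have := zj j; suff ji : j != i by move=> /(_ ji); lra.
by apply/eqP => ji; apply: ai; rewrite aj ji.
Qed.

Lemma slab_panel l m z v : enclosed S (slab l m) z -> panel v ->
  enclosed S (slab l m) (z + v).
Proof.
move=> /enclosed_slab[zi zj] /panelP[vi vj]; apply/enclosed_slab.
rewrite pairingD zi vi addr0; split=> // j ji.
by rewrite pairingD; have := zj j ji; have := vj j ji; lra.
Qed.

Lemma adjacent_flow B f A g A' g' p p' t : chart B f ->
  chart A g -> sgerm S g = sgerm S f ->
  chart A' g' -> sgerm S g' = sgerm S (fun z => f (refl_mx R S i *m z)) ->
  g p = g' p' -> 0 <= t -> g (p + t *: v0) = g' (p' + t *: v0).
Proof.
move=> cf cg gf cg' gf' gpp t0.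
have tv0 : dominant S (t *: v0) by apply: dominantZ => //; exact: panel_dominant panel_v0.
have cfr := chart_weyl masureM cf (weyl_refl R S i).
have [A1 [g1 [p1 [cg1 e1 gp1 [u1 ag1]]]]] := sgerm_chart_point masureM (g p) cf.
have [A2 [g2 [p2 [cg2 e2 gp2 [u2 ag2]]]]] := sgerm_chart_point masureM (g p) cfr.
rewrite (sgerm_flow masureM cg cg1 (q := p1)) ?gf ?e1 ?gp1 //.
rewrite -(sgerm_flow masureM cg2 cg' (p := p2)) ?gf' ?e2 ?gp2 //.
have rv0 : refl_mx R S i *m v0 = v0 by rewrite refl_mxE v0i scale0r subr0.
have cg3 := chart_weyl masureM cg2 (weyl_refl R S i).
set g3 := fun z => _ in cg3.
have -> : g2 (p2 + t *: v0) = g3 (refl_mx R S i *m p2 + t *: v0).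
  by rewrite /g3 mulmxDr reflK -scalemxAr rv0.
(* [g1] agrees with [f] on the level [N1] of [al i], and [g3] on the level [- N2], as soon as the
   other simple roots are large. On the latter, [r i] adds [N2 * c i j] to [al j], which [N3]
   compensates. *)
have [N1 N1P] := nat_above (fun j => al j u1).
have [N2 N2P] := nat_above (fun j => al j u2).
have [N3 N3P] := nat_above (fun j => al j u2 - N2%:R * (cartan S i j)%:~R).
have [m [m1 m3]] : exists m : nat, (N1 <= m)%N /\ (N3 <= m)%N.
  by exists (maxn N1 N3); rewrite leq_maxl leq_maxr.
(* The segment of bases runs from level [- N2] to level [N1] in the direction [c] of the chamber. *)
have [c cP] := aroot_surj S (fun=> 1 : R).
have [b bP] := aroot_surj S (fun j => if j == i then - N2%:R else m%:R : R).
have H3 : panel_chart f (g p) b A2 g3 (slab (- N2%:Z) m) (refl_mx R S i *m p2).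
  split=> //.
  - by rewrite /g3 reflK.
  - by apply/enclosed_slab; split=> [|j ji]; rewrite bP ?eqxx ?(negPf ji) ?mulrNz.
  - exact: slab_panel.
  - move=> z /enclosed_slab[zi zj]; rewrite /g3 ag2 ?reflK // => j.
    rewrite pairingB aroot_refl zi mulrNz /=.
    have [->|ji] := eqVneq j i.
      by rewrite zi mulrNz /= cartan_diag; have := N2P i; rewrite /intr /=; lra.
    have := zj j ji; have := N3P j; have : (N3%:R : R) <= m%:R by rewrite ler_nat.
    rewrite /intr /=; lra.
have H1 : panel_chart f (g p) (b + (N1%:R + N2%:R) *: c) A1 g1 (slab N1 m) p1.
  split=> //.
  - apply/enclosed_slab; split=> [|j ji];
    rewrite pairingD pairingZ cP bP ?eqxx ?(negPf ji).
      by rewrite /intr /=; ring.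
    by have := ler0n R N1; have := ler0n R N2; rewrite /intr /=; lra.
  - exact: slab_panel.
  - move=> z /enclosed_slab[zi zj]; apply: ag1 => j; rewrite pairingB.
    have [->|ji] := eqVneq j i; first by rewrite zi; have := N1P i; rewrite /intr /=; lra.
    have := zj j ji; have := N1P j; have : (N1%:R : R) <= m%:R by rewrite ler_nat.
    rewrite /intr /=; lra.
apply/esym; apply: (panel_chart_connected cf _ _ t0 H3 H1).
  by move=> j; rewrite cP.
by rewrite addr_ge0.
Qed.

End PanelFlow.

(** * Norms *)

Section Norms.
Context (R : realType) (n : nat).
Local Notation AA := 'cV[R]_n.
Implicit Types (N : AA -> R) (x y : AA).

Lemma is_norm0 N : is_norm N -> N 0 = 0.
Proof. by move=> [_ NZ _]; rewrite -(scale0r (0 : AA)) NZ normr0 mul0r. Qed.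

Lemma is_normN N x : is_norm N -> N (- x) = N x.
Proof. by move=> [_ NZ _]; rewrite -scaleN1r NZ normrN1 mul1r. Qed.

Lemma is_norm_ge0 N x : is_norm N -> 0 <= N x.
Proof.
move=> nN; have [ND _ _] := nN; have := ND x (- x).
by rewrite subrr is_norm0 // is_normN //; lra.
Qed.

Lemma is_norm_sum N (J : finType) (F : J -> AA) : is_norm N ->
  N (\sum_j F j) <= \sum_j N (F j).
Proof.
move=> nN; have [ND _ _] := nN.
elim/big_ind2: _ => [|x1 x2 y1 y2 h1 h2|//]; first by rewrite is_norm0.
exact: le_trans (ND _ _) (lerD h1 h2).
Qed.

Lemma is_norm_le_coord N x (b : R) : is_norm N -> (forall l, `|x l 0| <= b) ->
  N x <= b * \sum_l N (delta_mx l 0).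
Proof.
move=> nN xb; have [_ NZ _] := nN.
have -> : x = \sum_l x l 0 *: delta_mx l 0.
  apply/matrixP => k j; rewrite ord1 summxE (bigD1 k) //= !mxE !eqxx mulr1.
  by rewrite big1 ?addr0 // => l /negPf lk; rewrite !mxE eq_sym lk mulr0.
apply: le_trans (is_norm_sum _ nN) _; rewrite mulr_sumr; apply: ler_sum => l _.
by rewrite NZ ler_wpM2r ?is_norm_ge0.
Qed.

(** [N] has a positive minimum on the compact unit sphere of the sup norm; [C] is its inverse. *)
Lemma is_norm_coord N : is_norm N ->
  exists2 C : R, 0 <= C & forall x l, `|x l 0| <= C * N x.
Proof.
move=> nN; have [ND NZ N0] := nN.
have coord_le (v : 'rV[R]_n) l : `|v 0 l| <= `|v|.
  by rewrite [leRHS]mx_normrE; apply: (le_bigmax _ (fun ij => `|v ij.1 ij.2|) (0, l)).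
(* In dimension 0 the sphere is empty and there is no minimum to take. *)
have [n0|/card_gt0P[l0 _]] := posnP #|'I_n|.
  by exists 0 => // x l; have := card0_eq n0 l.
(* Transposed because [EVT_min_rV] is about row vectors. *)
pose f (v : 'rV[R]_n) := N v^T.
set D := \sum_l N (delta_mx l 0).
have fle v : f v <= `|v| * D.
  by apply: is_norm_le_coord => // l; rewrite mxE.
have D0 : 0 <= D by apply: sumr_ge0 => l _; exact: is_norm_ge0.
have fcont : continuous f.
  move=> v A /nbhs_ballP[e /= e0 eA].
  have e0' : 0 < e / (D + 1) by rewrite divr_gt0 // ltr_pwDr.
  apply/nbhs_ballP; exists (e / (D + 1)) => // u; rewrite -ball_normE /= => vu.
  apply: eA; rewrite -ball_normE /=.
  have h1 : f v - f u <= `|v - u| * D.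
    have := ND u^T (v - u)^T; rewrite -linearD subrKC.
    by have := fle (v - u); rewrite /f; lra.
  have h2 : f u - f v <= `|v - u| * D.
    have := ND v^T (u - v)^T; rewrite -linearD subrKC.
    by have := fle (u - v); rewrite /f distrC; lra.
  have h3 : `|v - u| * D < e.
    apply: le_lt_trans (_ : `|v - u| * (D + 1) < e); first by rewrite ler_wpM2l // lerDl.
    by rewrite -ltr_pdivlMr // ltr_pwDr.
  by rewrite ltr_norml; apply/andP; split; lra.
pose sph := [set v : 'rV[R]_n | `|v| = 1].
have sph0 : sph !=set0.
  have e0 : (delta_mx 0 l0 : 'rV[R]_n) != 0.
    apply/eqP => /matrixP/(_ 0 l0)/eqP; rewrite !mxE !eqxx oner_eq0; exact.
  exists (`|delta_mx 0 l0 : 'rV[R]_n|^-1 *: delta_mx 0 l0).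
  by rewrite /sph /= normrZ normfV normr_id mulVf // normr_eq0.
have csph : compact sph.
  apply: bounded_closed_compact.
    by exists 1; split=> // b b1 v /= ->; exact: ltW.
  rewrite (_ : sph = (fun v : 'rV[R]_n => `|v|) @^-1` [set 1]) //.
  by apply: preimage_closed => [v _|]; [exact: norm_continuous|exact: closed_eq].
have [v vs vmin] := EVT_min_rV sph0 csph (continuous_subspaceT fcont).
have fv0 : 0 < f v.
  rewrite lt_neqAle is_norm_ge0 // andbT eq_sym; apply/eqP => /N0 vT.
  have v0 : v = 0 by rewrite -(trmxK v) vT trmx0.
  move: vs; rewrite inE v0 /sph /= normr0 => /eqP.
  by rewrite eq_sym oner_eq0.
exists (f v)^-1; first by rewrite invr_ge0 ltW.
move=> x l; have [->|x0] := eqVneq x 0; first by rewrite is_norm0 // mxE normr0 mulr0.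
have xT0 : `|x^T| != 0 by rewrite normr_eq0 trmx_eq0.
have := vmin (`|x^T|^-1 *: x^T).
rewrite /sph inE /= normrZ normfV normr_id mulVf // => /(_ erefl).
rewrite /f linearZ /= trmxK NZ normfV normr_id => h.
have xT : 0 < `|x^T| by rewrite lt_neqAle eq_sym xT0 normr_ge0.
have := coord_le x^T l; rewrite mxE => hl.
rewrite mulrC ler_pdivlMr //; apply: le_trans (ler_wpM2r (ltW fv0) hl) _.
by rewrite mulrC -ler_pdivlMr // mulrC.
Qed.

Lemma is_norm_equiv N1 N2 : is_norm N1 -> is_norm N2 ->
  exists2 C : R, 0 < C & forall x, N2 x <= C * N1 x.
Proof.
move=> n1 n2; have [C C0 CP] := is_norm_coord n1.
set D := \sum_l N2 (delta_mx l 0).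
have D0 : 0 <= D by apply: sumr_ge0 => l _; exact: is_norm_ge0.
exists (C * D + 1) => [|x]; first by rewrite ltr_wpDl // mulr_ge0.
have := is_norm_le_coord n2 (CP x); have := is_norm_ge0 x n1; rewrite -/D; nra.
Qed.

Lemma is_norm_pairing N (a : 'rV[R]_n) : is_norm N ->
  exists2 C : R, 0 <= C & forall x, pairing a x <= C * N x.
Proof.
move=> nN; have [C C0 CP] := is_norm_coord nN.
exists ((\sum_l `|a 0 l|) * C) => [|x].
  by rewrite mulr_ge0 // sumr_ge0.
rewrite pairingE -mulrA mulr_suml; apply: ler_sum => l _.
apply: le_trans (ler_norm _) _; rewrite normrM.
by rewrite ler_wpM2l.
Qed.

End Norms.

(** * Distances *)

Section GermDistance.
Context (R : realType) (I : finType) (n : nat) (S : root_datum I n).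
Context (M : apartment_system R n) (masureM : is_masure S M).
Local Notation AA := 'cV[R]_n.
Local Notation al i x := (pairing (aroot R S i) x).
Local Notation chart := (@chart R n M).
Implicit Types (A B : set M) (f g : AA -> M) (x y z : M) (p q u v : AA)
  (N : AA -> R) (s : set_system M).

(** [dist] with norm and germ unbundled, so that the germ can vary while the norm stays. *)
Definition gdist N s x y : R :=
  inf [set N uu.1 + N uu.2 | uu in meeting S false s x y].

Lemma gdist_lbound N s x y : is_norm N ->
  has_lbound [set N uu.1 + N uu.2 | uu in meeting S false s x y].
Proof.
move=> nN; exists 0 => _ [uu _ <-].
by rewrite addr_ge0 // is_norm_ge0.
Qed.

Lemma meetingC s x y u v : meeting S false s x y (u, v) -> meeting S false s y x (v, u).
Proof. by case. Qed.

Lemma gdistC N s x y : gdist N s x y = gdist N s y x.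
Proof.
congr inf; apply/seteqP; split=> _ [[u v] uv <-]; rewrite /= addrC;
  by exists (v, u) => //; exact: meetingC uv.
Qed.

Context (B : set M) (f : AA -> M) (cf : chart B f) (N : AA -> R) (nN : is_norm N).
Local Notation s := (sgerm S f).

Lemma gdist_chart_le A g p q u v : chart A g -> sgerm S g = s ->
  dominant S u -> dominant S v -> p + u = q + v -> gdist N s (g p) (g q) <= N u + N v.
Proof.
move=> cg gf ud vd e; apply: (ge_inf (gdist_lbound s (g p) (g q) nN)).
exists (u, v) => //; split; rewrite /= ?closure_chamberE //.
by rewrite -gf !(splus_chart masureM _ cg) // e.
Qed.

Lemma meeting_exists x y : exists uu, meeting S false s x y uu.
Proof.
have [A1 [g1 [p1 [cg1 e1 gp1 [u1 ag1]]]]] := sgerm_chart_point masureM x cf.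
have [A2 [g2 [p2 [cg2 e2 gp2 [u2 ag2]]]]] := sgerm_chart_point masureM y cf.
(* The meeting point [z + p2] must lie above [p1], to be reached from [x], and above [u1] and [u2],
   where both charts agree with [f]. *)
have [z1 z1d h1] := dominant_above S (p1 - p2).
have [z3 z3d h3] := dominant_above S (u1 - p2).
have [z4 z4d h4] := dominant_above S (u2 - p2).
pose z := z1 + z3 + z4.
have zd1 : dominant S (z + p2 - p1).
  rewrite (_ : _ - p1 = z1 - (p1 - p2) + z3 + z4); last by rewrite /z; vec_ring.
  exact: dominantD (dominantD h1 z3d) z4d.
have zd3 : dominant S (z + p2 - u1).
  rewrite (_ : _ - u1 = z1 + (z3 - (u1 - p2)) + z4); last by rewrite /z; vec_ring.
  exact: dominantD (dominantD z1d h3) z4d.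
have zd4 : dominant S (z + p2 - u2).
  rewrite (_ : _ - u2 = z1 + z3 + (z4 - (u2 - p2))); last by rewrite /z; vec_ring.
  exact: dominantD (dominantD z1d z3d) h4.
have zd : dominant S z := dominantD (dominantD z1d z3d) z4d.
exists (z + p2 - p1, z); split; rewrite /= ?closure_chamberE //.
rewrite -{1}e1 -e2 -gp1 -gp2 (splus_chart masureM _ cg1) // (splus_chart masureM _ cg2) //
  (addrC p2) (addrC p1) subrK.
by rewrite ag1 ?ag2.
Qed.

Lemma splusD x u v : dominant S u -> dominant S v ->
  splus S false s x (u + v) = splus S false s (splus S false s x u) v.
Proof.
move=> ud vd; have [A1 [g1 [p1 [cg1 e1 gp1 _]]]] := sgerm_chart_point masureM x cf.
by rewrite -e1 -gp1 !(splus_chart masureM _ cg1) ?addrA //; exact: dominantD.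
Qed.

(** Moves towards one germ commute, so meeting pairs (u, u') of x, y and (v, v') of y, z combine
    into (u + v, v' + u') for x, z. *)
Lemma gdist_triangle x y z : gdist N s x z <= gdist N s x y + gdist N s y z.
Proof.
have ne a b : [set N uu.1 + N uu.2 | uu in meeting S false s a b] !=set0.
  by have [uu h] := meeting_exists a b; exists (N uu.1 + N uu.2); exists uu.
rewrite -lerBlDl; apply: lb_le_inf => // _ [[v v'] [vd vd' /= ve] <-].
rewrite lerBlDl -lerBlDr; apply: lb_le_inf => // _ [[u u'] [ud ud' /= ue] <-].
rewrite lerBlDr /=.
rewrite closure_chamberE /= in vd vd' ud ud'.
have [ND _ _] := nN.
have : gdist N s x z <= N (u + v) + N (v' + u').
  apply: (ge_inf (gdist_lbound s x z nN)); exists (u + v, v' + u') => //.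
  split; rewrite /= ?closure_chamberE; [exact: dominantD|exact: dominantD|].
  by rewrite (splusD x ud vd) ue -(splusD y ud' vd) addrC (splusD y vd ud') ve splusD.
have := ND u v; have := ND v' u'; rewrite /=; lra.
Qed.

Lemma gdistxx x : gdist N s x x <= 0.
Proof.
have [A1 [g1 [p1 [cg1 e1 gp1 _]]]] := sgerm_chart_point masureM x cf.
have d0 : dominant S (0 : AA) by move=> i; rewrite pairing0.
have := gdist_chart_le cg1 e1 d0 d0 (erefl (p1 + 0)).
by rewrite gp1 is_norm0 // addr0.
Qed.

End GermDistance.

(** * Length bounds when a panel is crossed *)

Section Adjacent.
Context (R : realType) (I : finType) (n : nat) (S : root_datum I n).
Context (M : apartment_system R n) (masureM : is_masure S M).
Local Notation AA := 'cV[R]_n.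
Local Notation al i x := (pairing (aroot R S i) x).
Local Notation co i := (acoroot R S i).
Local Notation r i := (refl_mx R S i).
Local Notation chart := (@chart R n M).
Implicit Types (A B : set M) (f g : AA -> M) (x y : M) (p q u v d z : AA)
  (w : 'M[R]_n).

Lemma tits_le_dominant p u : dominant S u -> tits_le S p (p + u).
Proof. by move=> ud; rewrite /tits_le addrC addKr; exact: tits_dominant. Qed.

(** The half-open interval is used because [A'] is not assumed to contain [g p]; the enclosure
    brings this endpoint in. *)
Lemma interval_iso A A' g p d : chart A g -> is_apt A' -> d <> 0 ->
  (tits_le S p (p + d) \/ tits_le S (p + d) p) ->
  (forall t, 0 < t <= 1 -> A' (g (p + t *: d))) ->
  exists phi, weyl_iso S A A' phi /\
    exists2 e : R, 0 < e & forall t, 0 <= t < e -> phi (g (p + t *: d)) = g (p + t *: d).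
Proof.
move=> cg aA' d0 pd dA'.
have seg t : 0 < t <= 1 -> segment_open_left p (p + d) (p + t *: d).
  by move=> t01; exists t => //; rewrite addrAC subrr add0r.
pose F := within (segment_open_left p (p + d)) (nbhs p).
have sit : ma2_situation S A A' (fmap g F).
  split=> //; first exact: cg.1.
    exists g, F; split=> //; first exact: cg.2.
    constructor 2; exists p, (p + d); split=> //; last by right.
    by move=> e; apply: d0; apply: (addrI p); rewrite addr0.
  exists (g @` segment_open_left p (p + d)).
    by apply: (@filterS _ (nbhs p) _ setT) => [z _ pz|]; [exists z|exact: filterT].
  move=> _ [_ [t t01 <-] <-]; rewrite addrAC subrr add0r; exact: dA'.
have [_ [phi iso [E clE Efix]]] := masure_MA2 masureM sit.
exists phi; split=> //.
have [|e e0 eE] := cl_apt_segment masureM (p := p) (v := d) clE cg.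
  move=> Z FZ; have [e e0 eZ] := nbhs_line d FZ.
  exists (Num.min e 1); first by rewrite lt_min e0 ltr01.
  move=> t /andP[t0]; rewrite lt_min => /andP[te t1].
  by apply: eZ; [rewrite gtr0_norm|apply: seg; rewrite t0 ltW].
by exists e => // t te; apply: Efix; exact: eE.
Qed.

(** (MA3) for the face at [p] along [V] gives an apartment containing the germ of [f] and the
    beginning of the segment; (MA2) compares the two charts there. *)
Lemma germ_transfer B f A g p d sg V : chart B f -> chart A g ->
  vface S sg V -> (forall t, 0 < t -> V (t *: d)) -> d <> 0 ->
  (forall t, 0 < t -> tits_le S p (p + t *: d) \/ tits_le S (p + t *: d) p) ->
  exists A' g' p' w (e : R), [/\ chart A' g', sgerm S g' = sgerm S f, weyl S w, 0 < e &
    forall t, 0 <= t < e -> g (p + t *: d) = g' (p' + t *: (w *m d))].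
Proof.
move=> cf cg Vs Vd d0 pd.
have fF : in_masure (@is_face R I n S) (fmap g (face S p V)).
  exists A; first exact: cg.1.
  by exists g, (face S p V); split=> //; [exact: cg.2|exists p, sg, V].
have [|A' [aA' Af [E FE EA]]] := masure_MA3 masureM (Rg := sgerm S f) (F :=
  fmap g (face S p V)).
  by split; [exact: (sgerm_splayed S cf)|left].
have [g' [cg' eg' _]] := sgerm_chart masureM cf aA' Af.
have [e1 e10 eE] := face_line FE Vd.
have e2 : 0 < e1 / 2 by lra.
(* [d] is rescaled so that all parameters up to 1 stay within the element [E] of the face. *)
have [||t /andP[t0 t1]|phi [iso [e3 e30 efix]]] :=
    interval_iso (p := p) (d := (e1 / 2) *: d) cg aA'.
- move/eqP; rewrite scaler_eq0 => /orP[/eqP|/eqP//]; lra.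
- exact: pd.
- rewrite scalerA; apply: EA; apply: eE; apply/andP; split; nra.
have [w [c [ww e]]] := weyl_iso_trans iso cg cg'.
exists A', g', (w *m p + c), w, (e3 * (e1 / 2)); split=> //; first by rewrite mulr_gt0.
move=> t /andP[t0 te].
have := efix (t / (e1 / 2)); rewrite scalerA mulfVK ?gt_eqF // => h.
rewrite -h; last first.
  by apply/andP; split; [apply: divr_ge0 => //; exact: ltW|rewrite ltr_pdivrMr].
by rewrite e mulmxDr -scalemxAr addrAC.
Qed.

Section Direction.
Context (i : I) (v0 : AA) (v0i : al i v0 = 0) (v0j : forall j, j != i -> al j v0 = 1).
Context (B : set M) (f : AA -> M) (cf : chart B f).
Local Notation s := (sgerm S f).
Local Notation s' := (sgerm S (fun z : AA => f (r i *m z))).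

Lemma adjacent_direction A g A' g' p p' u w L : chart A g -> sgerm S g = s ->
  chart A' g' -> sgerm S g' = s' -> weyl S w -> dominant S u -> 0 < L ->
  (forall t, 0 <= t <= L -> g (p + t *: u) = g' (p' + t *: (w *m u))) ->
  w *m u = u \/ w *m u = r i *m u.
Proof.
move=> cg gf cg' gf' ww ud L0 gg.
pose wu := w *m u.
(* [T] makes [al j] nonnegative, for j different from i, on both [y'] and [r i *m y']. *)
have [T1 T1P] := nat_above (fun j => - (L * al j wu)).
have [T2 T2P] := nat_above (fun j => - (L * al j (r i *m wu))).
pose T : R := T1%:R + T2%:R.
have T10 : 0 <= T1%:R :> R by exact: ler0n.
have T20 : 0 <= T2%:R :> R by exact: ler0n.
have T0 : 0 <= T by rewrite addr_ge0.
pose y := L *: u + T *: v0; pose y' := L *: wu + T *: v0.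
have v0d : dominant S v0 := panel_dominant (panel_v0 v0i v0j).
have yd : dominant S y by apply: dominantD; apply: dominantZ => //; exact: ltW.
have gy t : 0 <= t <= 1 -> g (p + t *: y) = g' (p' + t *: y').
  move=> /andP[t0 t1]; rewrite /y /y' !scalerDr !scalerA !addrA.
  apply: (adjacent_flow masureM v0i v0j cf cg gf cg' gf'); last by rewrite mulr_ge0.
  by apply: gg; apply/andP; split; nra.
(* As [y] is dominant, the segment is preordered and (MA2) applies unless [y] vanishes; injectivity
   of the chart settles that case. *)
have [w2 ww2 w2y] : exists2 w2, weyl S w2 & w2 *m y = y'.
  have [y0|/eqP y0] := eqVneq y 0.
    exists 1%:M; first exact: weyl1.
    have h0 := gy 0; have h1 := gy 1; rewrite y0 !scaler0 !addr0 in h0 h1.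
    rewrite mul1mx y0; apply: (addrI p'); rewrite addr0.
    apply: (chart_inj masureM cg'); move: h0 h1; rewrite scale0r scale1r addr0.
    by rewrite !lexx ler01 => h0 h1; rewrite -h0 // -h1.
  have [|t /andP[t0 t1]|phi [iso [e e0 efix]]] := interval_iso (p := p) (d :=
    y) cg cg'.1 y0.
  - by left; exact: tits_le_dominant.
  - by rewrite gy ?(ltW t0) //; exact: (chart_in masureM _ cg').
  have [w2 [c [ww2 ew2]]] := weyl_iso_trans iso cg cg'.
  exists w2 => //.
  have key t : 0 <= t < e -> t <= 1 -> w2 *m p + c + t *: (w2 *m y) = p' + t *: y'.
    move=> te t1; apply: (chart_inj masureM cg').
    rewrite -gy; last by rewrite t1 andbT; case/andP: te.
    by rewrite -efix // ew2 (mulmxDr w2 p) -scalemxAr [in RHS]addrAC.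
  pose t := Num.min (e / 2) 1.
  have t0 : 0 < t by rewrite lt_min ltr01 andbT; lra.
  have te : t < e by rewrite gt_min; apply/orP; left; lra.
  have t1 : t <= 1 by rewrite ge_min lexx orbT.
  have := key 0; rewrite lexx e0 ler01 !scale0r !addr0 => /(_ isT isT) k0.
  have := key t; rewrite te (ltW t0) t1 k0 => /(_ isT isT) /addrI.
  by apply: scalerI; rewrite gt_eqF.
have al_v0 j : j != i -> al j (T *: v0) = T by move=> ji; rewrite pairingZ v0j // mulr1.
have rv0 : r i *m v0 = v0 by rewrite refl_mxE v0i scale0r subr0.
have L0' : L != 0 by rewrite gt_eqF.
have [wi|wi] := lerP 0 (al i wu).
  have y'd : dominant S y'.
    move=> j; rewrite pairingD pairingZ; have [->|ji] := eqVneq j i.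
      by rewrite pairingZ v0i mulr0 addr0 mulr_ge0 // ltW.
    by rewrite al_v0 // /T; have := T1P j; lra.
  left; have := dominant_orbit_eq (w := w2) yd ww2; rewrite w2y => /(_ y'd) /addIr.
  by apply: scalerI.
have ry' : r i *m y' = L *: (r i *m wu) + T *: v0.
  by rewrite mulmxDr -!scalemxAr rv0.
have ry'd : dominant S (r i *m y').
  move=> j; rewrite ry' pairingD pairingZ; have [->|ji] := eqVneq j i.
    by rewrite pairingZ v0i mulr0 addr0 aroot_refl_diag mulr_ge0 ?oppr_ge0 // ltW.
  by rewrite al_v0 // /T; have := T2P j; lra.
right; rewrite -[LHS](reflK S i) -/wu; congr (_ *m _).
have := dominant_orbit_eq (w := r i *m w2) yd (weylM i ww2).
rewrite -mulmxA w2y => /(_ ry'd); rewrite ry' => /addIr.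
by apply: scalerI.
Qed.

Context (N : AA -> R) (nN : is_norm N) (e1 e2 : AA).
Context (e1d : dominant S e1) (e2d : dominant S e2) (e12 : e1 - e2 = co i).

(** Cost of moving by [u] or by [r i *m u = u - al i u *: co i]. The coroot need not be dominant, so
    it is split as [e1 - e2], and both parts are paid for. *)
Definition speed u := N u + al i u * (N e1 + N e2).

Lemma speed_ge0 u : dominant S u -> 0 <= speed u.
Proof.
move=> ud; apply: addr_ge0; first exact: is_norm_ge0.
by apply: mulr_ge0; [exact: ud|apply: addr_ge0; exact: is_norm_ge0].
Qed.

Lemma gdist_direction A' g' p u v t : chart A' g' -> sgerm S g' = s' -> dominant S u ->
  v = u \/ v = r i *m u -> 0 <= t ->
  gdist S N s' (g' p) (g' (p + t *: v)) <= speed u * t.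
Proof.
move=> cg' gf' ud vu t0; have [_ NZ _] := nN; have [ND _ _] := nN.
have cfr := chart_weyl masureM cf (weyl_refl R S i).
have a0 := ud i; have N1 := is_norm_ge0 e1 nN; have N2 := is_norm_ge0 e2 nN.
case: vu => ->.
  apply: le_trans (gdist_chart_le masureM nN cg' gf' (u := t *: u) (v := 0) _ _ _) _.
  - exact: dominantZ.
  - by move=> j; rewrite pairing0.
  - by rewrite addr0.
  rewrite is_norm0 // NZ ger0_norm // addr0 /speed mulrC ler_wpM2r //.
  by rewrite lerDl mulr_ge0 // addr_ge0.
(* Both points reach [p + t *: u + (t * al i u) *: e2] by dominant vectors. *)
apply: le_trans (gdist_chart_le masureM nN cg' gf' (u := t *: u + (t * al i u) *: e2)
  (v := (t * al i u) *: e1) _ _ _) _.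
- by apply: dominantD; apply: dominantZ => //; rewrite mulr_ge0.
- by apply: dominantZ => //; rewrite mulr_ge0.
- rewrite refl_mxE -e12; vec_ring.
have := ND (t *: u) ((t * al i u) *: e2).
rewrite !NZ !ger0_norm ?mulr_ge0 // /speed; lra.
Qed.

Lemma gdist_local A g p u : chart A g -> sgerm S g = s -> dominant S u ->
  (exists2 e : R, 0 < e & forall t, 0 < t < e ->
     gdist S N s' (g p) (g (p + t *: u)) <= speed u * t) /\
  (exists2 e : R, 0 < e & forall t, 0 < t < e ->
     gdist S N s' (g (p - t *: u)) (g p) <= speed u * t).
Proof.
move=> cg gf ud.
have cfr := chart_weyl masureM cf (weyl_refl R S i).
have [->|/eqP u0] := eqVneq u 0.
  by split; exists 1 => // t /andP[t0 _]; rewrite scaler0 ?subr0 ?addr0;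
    apply: le_trans (gdistxx masureM cfr nN _) _;
      rewrite mulr_ge0 ?(ltW t0) ?speed_ge0 // => j; rewrite pairing0.
(* The vectorial face containing [u], which may lie on walls. *)
pose J := [set j | al j u == 0]%SET.
have Ju t : 0 < t -> std_vface S J (t *: u).
  move=> t0; split=> j; rewrite inE pairingZ; first by move=> /eqP ->; rewrite mulr0.
  by move=> uj; rewrite mulr_gt0 // lt_neqAle eq_sym uj ud.
split.
  have [|A' [g' [p' [w [e [cg' gf' ww e0 h]]]]]] :=
    germ_transfer (p := p) cfr cg (vface_std R S J) Ju u0.
    by move=> t t0; left; apply: tits_le_dominant; apply: dominantZ => //; exact: ltW.
  exists e => // t /andP[t0 te].
  have wu : w *m u = u \/ w *m u = r i *m u.
    apply: (adjacent_direction (p := p) (p' := p') cg gf cg' gf' ww ud t0).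
    by move=> t' /andP[t'0 t't]; apply: h; rewrite t'0; exact: le_lt_trans te.
  have := h 0; rewrite lexx e0 !scale0r !addr0 => -> //.
  rewrite (h t); last by rewrite te ltW.
  exact: (gdist_direction _ cg' gf' ud wu (ltW t0)).
have [t t0|||A' [g' [p' [w [e [cg' gf' ww e0 h]]]]]] :=
  germ_transfer (p := p) (d := - u) cfr cg (vface_stdN R S J) _ _ _.
- by exists (t *: u); [exact: Ju|rewrite scalerN].
- by move=> /eqP; rewrite oppr_eq0 => /eqP.
- move=> t t0; right; rewrite /tits_le scalerN subKr.
  by apply: tits_dominant; apply: dominantZ => //; exact: ltW.
exists e => // t /andP[t0 te].
(* The piece was obtained in the direction [- u]; read from its other end it has the dominant
   direction that [adjacent_direction] requires. *)
have gE t' : 0 <= t' <= t -> g (p - t *: u + t' *: u) = g' (p' - t *: (w *m u) + t' *: (w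
  *m u)).
  move=> /andP[t'0 t't]; rewrite -!addrA -!scaleNr -!scalerDl.
  rewrite (_ : - t + t' = - (t - t')); last by ring.
  rewrite !scaleNr -!scalerN h ?mulmxN //; apply/andP; split; lra.
have wu : w *m u = u \/ w *m u = r i *m u.
  exact: (adjacent_direction cg gf cg' gf' ww ud t0 gE).
have := gE t; rewrite lexx (ltW t0) subrK => -> //.
have := gE 0; rewrite lexx (ltW t0) !scale0r !addr0 => -> //.
exact: (gdist_direction _ cg' gf' ud wu (ltW t0)).
Qed.

Lemma gdist_flow A g p u : chart A g -> sgerm S g = s -> dominant S u ->
  gdist S N s' (g p) (g (p + u)) <= speed u.
Proof.
move=> cg gf ud; have cfr := chart_weyl masureM cf (weyl_refl R S i).
pose P (t : R) : Prop := gdist S N s' (g p) (g (p + t *: u)) <= speed u * t.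
have tri := gdist_triangle masureM cfr nN.
suff : P 1 by rewrite /P scale1r mulr1.
apply: (real_induction (P := P) ler01).
- by rewrite /P scale0r addr0 mulr0; exact: (gdistxx masureM cfr nN).
- move=> t _ Pt; have [[e e0 h] _] := gdist_local (p + t *: u) cg gf ud.
  exists e => // t' /andP[tt' t'e]; rewrite /P.
  have := h (t' - t); rewrite -addrA -scalerDl subrKC => h'.
  apply: le_trans (tri _ (g (p + t *: u)) _) _.
  have {}h' : gdist S N s' (g (p + t *: u)) (g (p + t' *: u)) <= speed u * (t' - t).
    by apply: h'; apply/andP; split; lra.
  move: Pt; rewrite /P; lra.
- move=> t _ near; have [_ [e e0 h]] := gdist_local (p + t *: u) cg gf ud.
  have [t' [/andP[t'e t't] _ Pt']] := near e e0; rewrite /P.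
  have := h (t - t'); rewrite -addrA -scalerBl (_ : t - (t - t') = t'); last by ring.
  move=> h'; apply: le_trans (tri _ (g (p + t' *: u)) _) _.
  have {}h' : gdist S N s' (g (p + t' *: u)) (g (p + t *: u)) <= speed u * (t - t').
    by apply: h'; apply/andP; split; lra.
  move: Pt'; rewrite /P; lra.
Qed.

End Direction.

Lemma gdist_le_mul N s s1 x y C : 0 < C -> (exists uu, meeting S false s x y uu) ->
  (forall uu, meeting S false s x y uu -> s1 <= C * (N uu.1 + N uu.2)) ->
  s1 <= C * gdist S (M := M) N s x y.
Proof.
move=> C0 [uu0 m0] h; rewrite mulrC -ler_pdivrMr //; apply: lb_le_inf.
  by exists (N uu0.1 + N uu0.2); exists uu0.
by move=> _ [uu m <-]; rewrite ler_pdivrMr // mulrC; exact: h.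
Qed.

(** [C] is chosen before the chart, so that it serves at every panel of type [i] in a gallery. It
    comes from [al i v <= C1 * N v], which bounds [speed v] by [(1 + C1 * K) * N v]. *)
Lemma gdist_adjacent N i : is_norm N -> exists2 C : R, 0 < C &
  forall B f, chart B f -> forall x y,
    gdist S N (sgerm S (fun z : AA => f (r i *m z))) x y <= C * gdist S N (sgerm S f) x y.
Proof.
move=> nN; have [v0 v0P] := aroot_surj S (fun j => (j != i)%:R : R).
have v0i : al i v0 = 0 by rewrite v0P eqxx.
have v0j j : j != i -> al j v0 = 1 by rewrite v0P => ->.
have [e1 e1d e2d] := dominant_above S (co i).
have e12 : e1 - (e1 - co i) = co i by rewrite subKr.
have [C1 C10 C1P] := is_norm_pairing (aroot R S i) nN.
have N1 := is_norm_ge0 e1 nN; have N2 := is_norm_ge0 (e1 - co i) nN.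
set K := N e1 + N (e1 - co i).
have K0 : 0 <= K by rewrite addr_ge0.
exists (1 + C1 * K) => [|B f cf x y]; first by rewrite ltr_pwDl ?ltr01 ?mulr_ge0.
have cfr := chart_weyl masureM cf (weyl_refl R S i).
apply: gdist_le_mul; first by rewrite ltr_pwDl ?ltr01 ?mulr_ge0.
  exact: (meeting_exists masureM cf).
move=> [u u'] [/= ud ud' ue]; rewrite closure_chamberE in ud ud'.
apply: le_trans (gdist_triangle masureM cfr nN _ (splus S false (sgerm S f) x u) _) _.
rewrite {2}ue (gdistC _ _ _ _ y).
have flow x0 v : dominant S v ->
    gdist S N (sgerm S (fun z : AA => f (r i *m z))) x0 (splus S false (sgerm S f) x0 v)
      <= (1 + C1 * K) * N v.
  move=> vd; have [A [g [p [cg gf gp _]]]] := sgerm_chart_point masureM x0 cf.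
  rewrite -[in X in gdist _ _ _ _ X]gf -gp (splus_chart masureM _ cg) //.
  have := gdist_flow v0i v0j cf nN e1d e2d e12 p cg gf vd; rewrite /speed -/K.
  have := C1P v; have := is_norm_ge0 v nN; nra.
by rewrite mulrDr; apply: lerD; exact: flow.
Qed.

Lemma gdist_weyl N w : is_norm N -> weyl S w -> exists2 C : R, 0 < C &
  forall B f, chart B f -> forall x y,
    gdist S N (sgerm S (fun z : AA => f (w *m z))) x y <= C * gdist S N (sgerm S f) x y.
Proof.
move=> nN; elim=> [|i w0 ww0 [C C0 CP]].
  exists 1 => // B f _ x y; rewrite mul1r (_ : (fun z => _) = f) //.
  by apply/funext => z; rewrite mul1mx.
have [C1 C10 C1P] := gdist_adjacent i nN.
exists (C * C1) => [|B f cf x y]; first by rewrite mulr_gt0.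
(* After the first panel of the gallery is crossed, its remainder [w0] starts from the chart [f]
   composed with [r i]. *)
have := CP _ _ (chart_weyl masureM cf (weyl_refl R S i)) x y.
have -> : (fun z : AA => f (r i *m (w0 *m z))) = (fun z : AA => f (r i *m w0 *m z)).
  by apply/funext => z; rewrite mulmxA.
move=> /le_trans; apply; rewrite -mulrA ler_pM2l //.
exact: C1P cf x y.
Qed.

(** Lets a sector germ be the second filter in (MA3). The chamber spans the space, so the support is
    everything and its pointwise stabilizer is trivial. *)
Lemma sgerm_solid A f : chart A f ->
  in_masure (@is_solid_chimney_germ R I n S) (sgerm S f).
Proof.
move=> cf; exists A; first exact: cf.1.
exists f, (chimney_germ S (face S 0 (std_vface S [set: I])) (std_chamber S)).
split; [exact: cf.2| |exact: sgermE].
exists (face S 0 (std_vface S [set: I])), false, (std_chamber S); split=> //.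
- by exists 0, false, (std_vface S [set: I]); split=> //; exact: vface_std.
- rewrite std_chamberE; exact: vface_std.
exists 0, fullv; split; last first.
  apply: (sub_finite_set _ (finite_set1 (1%:M : 'M[R]_n))) => w [_ wfix].
  by apply: mulmx_cV_inj => u; rewrite wfix ?memvf // mul1mx.
split.
  exists (fun=> None); split; last by move=> z _; rewrite /affine_space /= memvf.
  exists setT => //; exists (fun=> None), (fun=> None), setT; split=> //.
  exact: filterT.
move=> p U [k [[E0 F0 E0k] kU]] z _.
have CU c : std_chamber S c -> c - p \in U.
  move=> cc; apply: kU; apply: E0k; exists 0; last by exists c => //; rewrite add0r.
  by apply: face_center F0 _; split=> j; rewrite ?inE // pairing0.
have [c0 c0c] := chamber_nonempty R S.
have allU (x : AA) : x \in U.
  have [y yd yx] := dominant_above S (- x).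
  rewrite (_ : x = (y - - x + c0 - p) - (y + c0 - p)); last by vec_ring.
  by apply: rpredB; apply: CU; exact: chamberD.
exact: allU.
Qed.

End Adjacent.

Lemma dist_le (R : realType) (I : finType) (n : nat) (S : root_datum I n)
  (M : apartment_system R n) (masureM : is_masure S M)
  (theta1 theta2 : theta S M false) :
  exists2 C : R, 0 < C & forall x y : M, dist theta2 x y <= C * dist theta1 x y.
Proof.
have nN1 := theta_normP theta1; have nN2 := theta_normP theta2.
have [A1 [f1 [cf1 s1]]] := sector_germ_chart masureM (theta_germP theta1).
have [A2 [f2 [cf2 s2]]] := sector_germ_chart masureM (theta_germP theta2).
have [|A [aA Af1 Af2]] := masure_MA3 masureM (Rg := sgerm S f1) (F := sgerm S f2).
  by split; [exact: (sgerm_splayed S cf1)|right; exact: (sgerm_solid S cf2)].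
have [g1 [cg1 e1 _]] := sgerm_chart masureM cf1 aA Af1.
have [g2 [cg2 e2 _]] := sgerm_chart masureM cf2 aA Af2.
have [w [c [ww e]]] := chart_trans masureM cg1 cg2.
have [c' ec] := weyl_unit ww c.
have g2E : sgerm S g2 = sgerm S (fun z => g1 (w *m z)).
  rewrite -(sgerm_translate S (fun z => g1 (w *m z)) c'); congr sgerm; apply/funext => z.
  by rewrite e mulmxDr ec.
have [C1 C10 C1P] := gdist_weyl masureM nN1 ww.
have [C2 C20 C2P] := is_norm_equiv nN1 nN2.
exists (C2 * C1) => [|x y]; first by rewrite mulr_gt0.
rewrite -mulrA; apply: le_trans (_ : C2 * gdist S (theta_norm theta1) (sgerm S g2) x y <=
  _).
  have -> : dist theta2 x y = gdist S (theta_norm theta2) (sgerm S g2) x y.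
    by rewrite /dist /gdist s2 e2.
  apply: gdist_le_mul => //; first exact: (meeting_exists masureM cg2).
  move=> uu m; apply: (@le_trans _ _ (theta_norm theta2 uu.1 + theta_norm theta2 uu.2)).
    by apply: (ge_inf (gdist_lbound S (sgerm S g2) x y nN2)); exists uu.
  by rewrite mulrDr lerD.
rewrite ler_pM2l // g2E.
have -> : dist theta1 x y = gdist S (theta_norm theta1) (sgerm S g1) x y.
  by rewrite /dist /gdist s1 e1.
exact: C1P cg1 x y.
Qed.

Theorem theorem36 (R : realType) (I : finType) (n : nat) (S : root_datum I n)
  (M : apartment_system R n) (masureM : is_masure S M)
  (thickM : thick_locally_finite S M)
  (G : groupType) (act : G -> M -> M) (strongG : strongly_transitive S act)
  (A0 : set M) (f0 : 'cV[R]_n -> M) (aptA0 : is_apt A0)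
  (chart0 : apt_isom A0 f0) (stabA0 : model_stabilizer S act A0 f0)
  (theta1 theta2 : theta S M false) :
  exists k l : R, [/\ 0 < k, 0 < l &
    forall x x' : M, k * dist theta1 x x' <= dist theta2 x x' /\
                     dist theta2 x x' <= l * dist theta1 x x'].
Proof.
have [l l0 lP] := dist_le masureM theta1 theta2.
have [m m0 mP] := dist_le masureM theta2 theta1.
exists m^-1, l; split; rewrite ?invr_gt0 // => x x'; split=> //.
by rewrite mulrC ler_pdivrMr // mulrC.
Qed.
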